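(* Let $G_1,G_2,G_3$ be abelian groups and $n,m,k\ge0$ natural numbers. Let $\alpha:(G_1\otimes G_2)\otimes G_3\cong G_1\otimes(G_2\otimes G_3)$ be the associativity isomorphism and let $\alpha_*:K((G_1\otimes G_2)\otimes G_3,(n+m)+k)\simeq K(G_1\otimes(G_2\otimes G_3),n+(m+k))$ be the equivalence induced by $\alpha$ (and the equality $(n+m)+k=n+(m+k)$). Then for all $x:K(G_1,n)$, $y:K(G_2,m)$, $z:K(G_3,k)$, $$x\smile_k(y\smile_k z)=\alpha_*\big((x\smile_k y)\smile_k z\big).$$
   Context: We work in Homotopy Type Theory (as in the HoTT Book). $\Omega(A):=(\star_A=\star_A)$ for a pointed type $(A,\star_A)$; $A\to_\star B$ is the type of pointed maps. $\Sigma A$ is the suspension, with constructors $\mathsf{north},\mathsf{south}$ and $\mathsf{merid}\,a:\mathsf{north}=\mathsf{south}$ for $a:A$. $\|A\|_n$ is the $n$-truncation, with canonical elements $|a|$. Eilenberg-MacLane spaces. For an abelian group $G$, $\widetilde K(G,1)$ is the higher inductive type generated by a point $\star$, a path $\mathsf{loop}_k\,g:\star=\star$ for every $g:G$, and for all $g_1,g_2:G$ a filler witnessing $\mathsf{loop}_k\,g_1\cdot\mathsf{loop}_k\,g_2=\mathsf{loop}_k(g_1+g_2)$. For $n>1$, $\widetilde K(G,n):=\Sigma\,\widetilde K(G,n-1)$. The basepoint $0_k$ of $\widetilde K(G,n)$ is $\star$ if $n=1$ and $\mathsf{north}$ if $n>1$. $K(G,0):=G$ with basepoint $0_G$, and $K(G,n):=\|\widetilde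 K(G,n)\|_n$ with basepoint $|0_k|$ for $n\ge1$; all basepoints are written $0_k$. A homomorphism $\phi:G_1\to G_2$ induces $\phi_n:K(G_1,n)\to K(G_2,n)$: $\phi_0:=\phi$; $\phi_1(\star):=\star$ and $\mathsf{ap}_{\phi_1}(\mathsf{loop}_k\,g):=\mathsf{loop}_k(\phi(g))$; $\phi_n:=\Sigma(\phi_{n-1})$ for $n\ge2$ (on raw spaces). The map $\sigma_n:K(G,n)\to\Omega K(G,n+1)$ is $\sigma_0(g):=\mathsf{loop}_k\,g$ and, for $n\ge1$, is induced by $x\mapsto\mathsf{merid}\,x\cdot(\mathsf{merid}\,0_k)^{-1}$ for $x:\widetilde K(G,n)$. Cup product. $G_1\otimes G_2$ is the tensor product of abelian groups (a set, constructed as a higher inductive type, with the usual universal property). First define $\smile_k':\widetilde K(G_1,n)\times K(G_2,m)\to K(G_1\otimes G_2,n+m)$ (with $\widetilde K(G_1,0):=G_1$). For $n=0$, $g\smile_k'(-):=(g\otimes(-))_m$, the functorial action on the homomorphism $g\otimes(-):G_2\to G_1\otimes G_2$. For $n=1$, $\star\smile_k'y:=0_k$ and $\mathsf{ap}_{x\mapsto x\smile_k'y}(\mathsf{loop}_k\,g):=\sigma_m(g\smile_k'y)$. For $n\ge2$, $\mathsf{north}\smile_k'y:=0_k$, $\mathsf{south}\smile_k'y:=0_k$ and $\mathsf{ap}_{x\mapsto x\smile_k'y}(\mathsf{merid}\,a):=\sigma_{(n-1)+m}(a\smile_k'y)$. Each $x\smile_k'(-)$ is pointed, so $\smile_k'$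 is a map $\widetilde K(G_1,n)\to(K(G_2,m)\to_\star K(G_1\otimes G_2,n+m))$; the codomain is an $n$-type, so it lifts uniquely to $\smile_k:K(G_1,n)\to(K(G_2,m)\to_\star K(G_1\otimes G_2,n+m))$. *)

(* Defs.v *)
(* Homotopy type theory, in the style of two-level type theory.

   The types of HoTT are the Rocq types [A] equipped with [Fib A]; they are closed under
   Rocq's dependent products and sums.  Their identity type is [x == y] (an abstract [Id]),
   whose eliminator [J] is available only for families of fibrant types, so that nothing
   about Rocq's inductive equality is imposed on it.  Rocq's strict equality [=] appears
   only where HoTT has a judgmental equality: the computation rule of [J] and those of the
   point constructors of higher inductive types, and arithmetic on [nat].  Function
   extensionality and the higher inductive types are fields of the class [HoTT].  Univalence
   is not assumed: the class also covers inner theories in which it holds. *)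

Class TypeFormers := {
  (* [Fib A] is a structure, not a property. *)
  Fib : Type -> Type;
  fib_unit : Fib unit;
  (* [nat] is then also the type of natural numbers of the inner theory. *)
  fib_nat : Fib nat;
  fib_pi : forall (A : Type) (B : A -> Type),
    Fib A -> (forall x, Fib (B x)) -> Fib (forall x, B x);
  fib_sig : forall (A : Type) (B : A -> Type),
    Fib A -> (forall x, Fib (B x)) -> Fib {x : A & B x};
  Id : forall A : Type, Fib A -> A -> A -> Type;
  fib_Id : forall (A : Type) (fA : Fib A) (x y : A), Fib (Id A fA x y);
  idpath : forall (A : Type) (fA : Fib A) (x : A), Id A fA x x;
  J : forall (A : Type) (fA : Fib A) (x : A) (P : forall y, Id A fA x y -> Type)
    (fP : forall y p, Fib (P y p)), P x (idpath A fA x) -> forall y p, P y p;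
  J_idpath : forall (A : Type) (fA : Fib A) (x : A) (P : forall y, Id A fA x y -> Type)
    (fP : forall y p, Fib (P y p)) (d : P x (idpath A fA x)),
    J A fA x P fP d x (idpath A fA x) = d
}.

Existing Class Fib.
#[export] Existing Instances fib_unit fib_nat fib_pi fib_sig fib_Id.

Arguments Fib {_} A.
Arguments Id {_} {A} {fA} x y.
Arguments idpath {_} {A} {fA} {x}.
Arguments J {_} {A} {fA} {x} P {fP} d {y} p.
Arguments J_idpath {_} {A} {fA} {x} P {fP} d.

Notation "x == y" := (Id x y) (at level 70, no associativity).
Notation "x == y :> A" := (@Id _ A _ x y)
  (at level 70, y at next level, no associativity).

Ltac path_ind p :=
  lazymatch type of p with
  | @Id ?T ?A ?fA ?x ?y =>
    pattern y, p;
    lazymatch goal with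
    | |- ?P _ _ => refine (@J T A fA x P _ _ y p); cbv beta
    end
  end.

Declare Scope path_scope.
Open Scope path_scope.

Section Paths.
Context {T : TypeFormers}.

Definition transport {A : Type} {fA : Fib A} (P : A -> Type) {fP : forall x, Fib (P x)}
  {x y : A} (p : x == y) : P x -> P y := J (fun y _ => P x -> P y) (fun u => u) p.

Definition concat {A : Type} {fA : Fib A} {x y z : A} (p : x == y) (q : y == z) : x == z :=
  transport (fun z => x == z) q p.

Definition inv {A : Type} {fA : Fib A} {x y : A} (p : x == y) : y == x :=
  transport (fun y => y == x) p idpath.

Definition ap {A B : Type} {fA : Fib A} {fB : Fib B} (f : A -> B) {x y : A} (p : x == y)
  : f x == f y := transport (fun y => f x == f y) p idpath.

Definition happly {A : Type} {fA : Fib A} {P : A -> Type} {fP : forall x, Fib (P x)}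
  {f g : forall x, P x} (p : f == g) (x : A) : f x == g x :=
  transport (fun g => f x == g x) p idpath.

Definition of_eq {A : Type} {fA : Fib A} {x y : A} (e : x = y) : x == y :=
  match e with eq_refl => idpath end.

Definition transport_id {A : Type} {fA : Fib A} (P : A -> Type) {fP : forall x, Fib (P x)}
  (x : A) : (fun u : P x => u) = transport P idpath :=
  eq_sym (J_idpath (fun y _ => P x -> P y) (fun u => u)).

Lemma transport_1 {A : Type} {fA : Fib A} (P : A -> Type) {fP : forall x, Fib (P x)}
  {x : A} (u : P x) : transport P idpath u = u.
Proof. now destruct (transport_id P x). Defined.

Lemma concat_p1 {A : Type} {fA : Fib A} {x y : A} (p : x == y) : concat p idpath = p.
Proof. apply (transport_1 (fun z => x == z)). Defined.

Lemma inv_1 {A : Type} {fA : Fib A} {x : A} : inv (@idpath _ A fA x) = idpath.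
Proof. apply (transport_1 (fun z => z == x)). Defined.

Lemma ap_1 {A B : Type} {fA : Fib A} {fB : Fib B} (f : A -> B) {x : A}
  : ap f (@idpath _ A fA x) = idpath.
Proof. apply (transport_1 (fun y => f x == f y)). Defined.

Lemma happly_1 {A : Type} {fA : Fib A} {P : A -> Type} {fP : forall x, Fib (P x)}
  {f : forall x, P x} (x : A) : happly (@idpath _ (forall x, P x) _ f) x = idpath.
Proof. apply (transport_1 (fun g => f x == g x)). Defined.

Definition apD {A : Type} {fA : Fib A} {P : A -> Type} {fP : forall x, Fib (P x)}
  (f : forall x, P x) {x y : A} (p : x == y) : transport P p (f x) == f y :=
  J (fun y p => transport P p (f x) == f y) (of_eq (transport_1 P (f x))) p.

Definition ap2 {A B C : Type} {fA : Fib A} {fB : Fib B} {fC : Fib C} (f : A -> B -> C)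
  {x x' : A} {y y' : B} (p : x == x') (q : y == y') : f x y == f x' y' :=
  concat (ap (fun a => f a y) p) (ap (f x') q).

Definition transport_pp {A : Type} {fA : Fib A} (P : A -> Type) {fP : forall x, Fib (P x)}
  {x y z : A} (p : x == y) (q : y == z) (u : P x)
  : transport P (concat p q) u == transport P q (transport P p u).
Proof.
path_ind q.
exact (of_eq (eq_trans (f_equal (fun r => transport P r u) (concat_p1 p))
                      (eq_sym (transport_1 P _)))).
Defined.

Definition over_concat {A : Type} {fA : Fib A} {P : A -> Type} {fP : forall x, Fib (P x)}
  {x y z : A} {p : x == y} {q : y == z} {u : P x} {v : P y} {w : P z}
  (a : transport P p u == v) (b : transport P q v == w) : transport P (concat p q) u == w :=
  concat (transport_pp P p q u) (concat (ap (transport P q) a) b).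

Lemma concat_1p {A : Type} {fA : Fib A} {x y : A} (p : x == y) : concat idpath p == p.
Proof. path_ind p. rewrite concat_p1. exact idpath. Defined.

(* Changes the end points of a dependent path along strict equalities. *)
Definition cast_over {A : Type} {fA : Fib A} {P : A -> Type} {fP : forall x, Fib (P x)}
  {x y : A} {p : x == y} {u u' : P x} {v v' : P y} (eu : u = u') (ev : v = v')
  : transport P p u == v -> transport P p u' == v' :=
  match eu, ev with eq_refl, eq_refl => fun a => a end.

Lemma ap_id {A : Type} {fA : Fib A} {x y : A} (p : x == y) : ap (fun u => u) p == p.
Proof. path_ind p. rewrite ap_1. exact idpath. Defined.

Lemma apD_concat {A : Type} {fA : Fib A} {P : A -> Type} {fP : forall x, Fib (P x)}
  (f : forall x, P x) {x y z : A} (p : x == y) (q : y == z)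
  : over_concat (apD f p) (apD f q) == apD f (concat p q).
Proof.
path_ind q.
unfold over_concat, transport_pp.
rewrite (J_idpath (fun z q => transport P (concat p q) (f x) == transport P q (transport P p (f x)))).
unfold apD at 2; rewrite (J_idpath (fun y0 q => transport P q (f y) == f y0)).
generalize (concat_p1 p); generalize (concat p idpath); intros r e; destruct e.
unfold transport_1; destruct (transport_id P y); cbn.
rewrite concat_p1; exact (concat (concat_1p _) (ap_id _)).
Defined.
End Paths.
Notation "p @ q" := (concat p q) (at level 60, right associativity) : path_scope.

(* [is_trunc k A]: the type [A] is a (k-2)-type. *)
Fixpoint is_trunc {T : TypeFormers} (k : nat) (A : Type) {fA : Fib A} : Type :=
  match k with
  | O => {c : A & forall x : A, c == x}
  | S k => forall x y : A, is_trunc k (x == y)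
  end.

Record AbGroup {T : TypeFormers} := {
  gcar :> Type;
  gfib : Fib gcar;
  gset : is_trunc 2 gcar;
  gzero : gcar;
  gadd : gcar -> gcar -> gcar;
  gopp : gcar -> gcar;
  gadd_assoc : forall x y z, gadd x (gadd y z) == gadd (gadd x y) z;
  gadd_comm : forall x y, gadd x y == gadd y x;
  gadd_0 : forall x, gadd gzero x == x;
  gadd_opp : forall x, gadd (gopp x) x == gzero
}.
#[export] Existing Instance gfib.
Arguments gzero {_} _.
Arguments gadd {_ _} _ _.
Arguments gopp {_ _} _.
Arguments gset {_} _.

Declare Scope ab_scope.
Open Scope ab_scope.
Notation "x + y" := (gadd x y) : ab_scope.

Record Hom {T : TypeFormers} (G H : AbGroup) := {
  hom_fun :> G -> H;
  hom_add : forall x y, hom_fun (x + y) == hom_fun x + hom_fun y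
}.
Arguments hom_fun {_ _ _} _ _.
Arguments hom_add {_ _ _} _ _ _.

(* The action of a section [f] on a filler [w], the value of [f] at [a] being [s] up to strict
   equality; needed for the computation rule of [loop_add] below. *)
Definition section_filler {T : TypeFormers} {A : Type} {fA : Fib A} {P : A -> Type}
  {fP : forall x, Fib (P x)} (f : forall x, P x) {a : A} {s : P a} (e : f a = s)
  {p q r : a == a} (w : p @ q == r)
  : transport (fun r => transport P r s == s) w
      (over_concat (cast_over e e (apD f p)) (cast_over e e (apD f q)))
    == cast_over e e (apD f r).
Proof.
destruct e; cbn.
exact (ap (transport _ w) (apD_concat f p q) @ apD (fun r => apD f r) w).
Defined.

(* [K1 G] is generated by [star], [loop] and [loop_add].  The tensor product is specified by
   its universal property among abelian groups. *)
Class HoTT := {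
  formers :: TypeFormers;

  funext : forall (A : Type) (fA : Fib A) (P : A -> Type) (fP : forall x, Fib (P x))
    (f g : forall x, P x), (forall x, f x == g x) -> f == g;
  happly_funext : forall A fA P fP f g (h : forall x, f x == g x),
    happly (funext A fA P fP f g h) == h;
  funext_happly : forall A fA P fP f g (p : f == g),
    funext A fA P fP f g (happly p) == p;

  (* [Trunc k A] is the (k-2)-truncation of [A]. *)
  Trunc : nat -> forall A : Type, Fib A -> Type;
  fib_Trunc :: forall k A fA, Fib (Trunc k A fA);
  tr : forall k A fA, A -> Trunc k A fA;
  Trunc_is_trunc : forall k A fA, is_trunc k (Trunc k A fA);
  Trunc_ind : forall k A fA (P : Trunc k A fA -> Type) (fP : forall x, Fib (P x)),
    (forall x, is_trunc k (P x)) -> (forall a, P (tr k A fA a)) -> forall x, P x;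
  Trunc_ind_tr : forall k A fA P fP t d a,
    Trunc_ind k A fA P fP t d (tr k A fA a) = d a;

  Susp : forall A : Type, Fib A -> Type;
  fib_Susp :: forall A fA, Fib (Susp A fA);
  north : forall A fA, Susp A fA;
  south : forall A fA, Susp A fA;
  merid : forall A fA, A -> north A fA == south A fA;
  Susp_ind : forall A fA (P : Susp A fA -> Type) (fP : forall x, Fib (P x))
    (n : P (north A fA)) (s : P (south A fA)),
    (forall a, transport P (merid A fA a) n == s) -> forall x, P x;
  Susp_ind_north : forall A fA P fP n s m,
    Susp_ind A fA P fP n s m (north A fA) = n;
  Susp_ind_south : forall A fA P fP n s m,
    Susp_ind A fA P fP n s m (south A fA) = s;
  Susp_ind_merid : forall A fA P fP n s m a,
    cast_over (Susp_ind_north A fA P fP n s m) (Susp_ind_south A fA P fP n s m)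
      (apD (Susp_ind A fA P fP n s m) (merid A fA a)) == m a;

  K1 : AbGroup -> Type;
  fib_K1 :: forall G, Fib (K1 G);
  star : forall G, K1 G;
  loop : forall G : AbGroup, G -> star G == star G;
  loop_add : forall (G : AbGroup) (g h : G), loop G g @ loop G h == loop G (g + h);
  K1_ind : forall (G : AbGroup) (P : K1 G -> Type) (fP : forall x, Fib (P x)) (s : P (star G))
    (l : forall g, transport P (loop G g) s == s),
    (forall g h, transport (fun r => transport P r s == s) (loop_add G g h)
                   (over_concat (l g) (l h)) == l (g + h)) ->
    forall x, P x;
  K1_ind_star : forall G P fP s l w, K1_ind G P fP s l w (star G) = s;
  K1_ind_loop : forall G P fP s l w g,
    cast_over (K1_ind_star G P fP s l w) (K1_ind_star G P fP s l w)
      (apD (K1_ind G P fP s l w) (loop G g)) == l g;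
  K1_ind_loop_add : forall (G : AbGroup) P fP s l w (g h : G),
    section_filler (K1_ind G P fP s l w) (K1_ind_star G P fP s l w) (loop_add G g h)
      @ K1_ind_loop G P fP s l w (g + h)
    == ap (transport _ (loop_add G g h))
         (ap2 over_concat (K1_ind_loop G P fP s l w g) (K1_ind_loop G P fP s l w h))
      @ w g h;

  tensor : AbGroup -> AbGroup -> AbGroup;
  pure : forall G H : AbGroup, G -> H -> tensor G H;
  pure_addl : forall (G H : AbGroup) (g g' : G) (h : H),
    pure G H (g + g') h == pure G H g h + pure G H g' h;
  pure_addr : forall (G H : AbGroup) (g : G) (h h' : H),
    pure G H g (h + h') == pure G H g h + pure G H g h';
  tensor_rec : forall (G H L : AbGroup) (b : G -> H -> L),
    (forall g g' h, b (g + g') h == b g h + b g' h) ->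
    (forall g h h', b g (h + h') == b g h + b g h') ->
    Hom (tensor G H) L;
  tensor_rec_pure : forall G H L b bl br g h,
    tensor_rec G H L b bl br (pure G H g h) == b g h;
  tensor_ext : forall (G H L : AbGroup) (f f' : Hom (tensor G H) L),
    (forall g h, f (pure G H g h) == f' (pure G H g h)) -> forall t, f t == f' t
}.

Arguments funext {_} {A fA P fP f g} h.
Arguments happly_funext {_} {A fA P fP f g} h.
Arguments funext_happly {_} {A fA P fP f g} p.
Arguments Trunc {_} k A {fA}.
Arguments fib_Trunc {_} k A {fA}.
Arguments tr {_} k {A fA} a.
Arguments Trunc_is_trunc {_} k A {fA}.
Arguments Trunc_ind {_} k {A fA} P {fP} t d x.
Arguments Trunc_ind_tr {_} k {A fA} P {fP} t d a.
Arguments Susp {_} A {fA}.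
Arguments north {_ A fA}.
Arguments south {_ A fA}.
Arguments merid {_ A fA} a.
Arguments Susp_ind {_ A fA} P {fP} n s m x.
Arguments Susp_ind_north {_ A fA} P {fP} n s m.
Arguments Susp_ind_south {_ A fA} P {fP} n s m.
Arguments Susp_ind_merid {_ A fA} P {fP} n s m a.
Arguments star {_ G}.
Arguments loop {_ G} g.
Arguments loop_add {_ G} g h.
Arguments K1_ind {_ G} P {fP} s l w x.
Arguments K1_ind_star {_ G} P {fP} s l w.
Arguments K1_ind_loop {_ G} P {fP} s l w g.
Arguments pure {_ G H} g h.
Arguments pure_addl {_ G H} g g' h.
Arguments pure_addr {_ G H} g h h'.
Arguments tensor_rec {_ G H L} b bl br.
Arguments tensor_rec_pure {_ G H L} b bl br g h.
Arguments tensor_ext {_ G H L} f f' e t.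

Section PathAlgebra.
Context {T : TypeFormers}.

Lemma concat_p1' {A : Type} {fA : Fib A} {x y : A} (p : x == y) : p @ idpath == p.
Proof. rewrite concat_p1; exact idpath. Defined.

Lemma concat_assoc {A : Type} {fA : Fib A} {x y z w : A}
  (p : x == y) (q : y == z) (r : z == w) : p @ (q @ r) == (p @ q) @ r.
Proof. path_ind r. rewrite !concat_p1. exact idpath. Defined.

Lemma concat_Vp {A : Type} {fA : Fib A} {x y : A} (p : x == y) : inv p @ p == idpath.
Proof. path_ind p. rewrite inv_1, concat_p1. exact idpath. Defined.

Lemma concat_pV {A : Type} {fA : Fib A} {x y : A} (p : x == y) : p @ inv p == idpath.
Proof. path_ind p. rewrite inv_1, concat_p1. exact idpath. Defined.

Lemma concat_V_pp {A : Type} {fA : Fib A} {x y z : A} (p : x == y) (q : y == z)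
  : inv p @ (p @ q) == q.
Proof. exact (concat_assoc _ _ _ @ ap (fun r => r @ q) (concat_Vp p) @ concat_1p q). Defined.

Lemma concat_p_Vp {A : Type} {fA : Fib A} {x y z : A} (p : x == y) (q : x == z)
  : p @ (inv p @ q) == q.
Proof. exact (concat_assoc _ _ _ @ ap (fun r => r @ q) (concat_pV p) @ concat_1p q). Defined.

Lemma cancelL {A : Type} {fA : Fib A} {x y z : A} (p : x == y) (q r : y == z)
  (e : p @ q == p @ r) : q == r.
Proof. exact (inv (concat_V_pp p q) @ ap (concat (inv p)) e @ concat_V_pp p r). Defined.

Lemma ap_pp {A B : Type} {fA : Fib A} {fB : Fib B} (f : A -> B) {x y z : A}
  (p : x == y) (q : y == z) : ap f (p @ q) == ap f p @ ap f q.
Proof. path_ind q. rewrite ap_1, !concat_p1. exact idpath. Defined.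

Lemma ap_V {A B : Type} {fA : Fib A} {fB : Fib B} (f : A -> B) {x y : A}
  (p : x == y) : ap f (inv p) == inv (ap f p).
Proof. path_ind p. rewrite ap_1, !inv_1, ap_1. exact idpath. Defined.

Lemma ap_compose {A B C : Type} {fA : Fib A} {fB : Fib B} {fC : Fib C}
  (f : A -> B) (g : B -> C) {x y : A} (p : x == y)
  : ap (fun x => g (f x)) p == ap g (ap f p).
Proof. path_ind p. rewrite !ap_1. exact idpath. Defined.

Lemma ap_const {A B : Type} {fA : Fib A} {fB : Fib B} (b : B) {x y : A} (p : x == y)
  : ap (fun _ => b) p == idpath.
Proof. path_ind p. rewrite ap_1. exact idpath. Defined.

Lemma ap_homotopy {A B : Type} {fA : Fib A} {fB : Fib B} {f g : A -> B}
  (h : forall x, f x == g x) {x y : A} (p : x == y) : ap f p @ h y == h x @ ap g p.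
Proof. path_ind p. rewrite !ap_1, concat_p1. exact (concat_1p _). Defined.

Lemma transport_eq {A B : Type} {fA : Fib A} {fB : Fib B} (f g : A -> B) {x y : A}
  (p : x == y) (u : f x == g x) (v : f y == g y) (e : u @ ap g p == ap f p @ v)
  : transport (fun x => f x == g x) p u == v.
Proof.
revert v e; path_ind p; intros v e.
rewrite !ap_1, concat_p1 in e; rewrite transport_1.
exact (e @ concat_1p v).
Defined.

Lemma transport_Vp {A : Type} {fA : Fib A} (P : A -> Type) {fP : forall x, Fib (P x)}
  {x y : A} (p : x == y) (u : P x) : transport P (inv p) (transport P p u) == u.
Proof. path_ind p. rewrite inv_1, !transport_1. exact idpath. Defined.

Lemma transport_pV {A : Type} {fA : Fib A} (P : A -> Type) {fP : forall x, Fib (P x)}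
  {x y : A} (p : x == y) (u : P y) : transport P p (transport P (inv p) u) == u.
Proof. revert u; path_ind p; intros u. rewrite inv_1, !transport_1. exact idpath. Defined.

Lemma contr_paths {A : Type} {fA : Fib A} (c : is_trunc 0 A) (x y : A) : is_trunc 0 (x == y).
Proof.
destruct c as [c h].
exists (inv (h x) @ h y); intros p; path_ind p; exact (concat_Vp (h x)).
Defined.

Lemma is_trunc_S (k : nat) : forall (A : Type) (fA : Fib A), is_trunc k A -> is_trunc (S k) A.
Proof.
induction k as [|k IH]; intros A fA h.
- exact (contr_paths h).
- intros x y; exact (IH _ _ (h x y)).
Defined.

Lemma is_trunc_add (j : nat) : forall (k : nat) (A : Type) (fA : Fib A),
  is_trunc k A -> is_trunc (j + k) A.
Proof.
induction j as [|j IH]; intros k A fA h; [exact h|].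
exact (is_trunc_S _ _ _ (IH _ _ _ h)).
Defined.

Lemma is_trunc_retract (k : nat) : forall (A B : Type) (fA : Fib A) (fB : Fib B)
  (r : A -> B) (s : B -> A) (e : forall b, r (s b) == b), is_trunc k A -> is_trunc k B.
Proof.
induction k as [|k IH]; intros A B fA fB r s e h.
- exists (r (projT1 h)); intros b; exact (ap r (projT2 h (s b)) @ e b).
- intros x y.
  refine (IH (s x == s y) (x == y) _ _ (fun p => inv (e x) @ ap r p @ e y) (ap s) _ (h _ _)).
  intros p; path_ind p. rewrite !ap_1.
  exact (ap (concat (inv (e x))) (concat_1p _) @ concat_Vp _).
Defined.
End PathAlgebra.

Section Sections.
Context {T : HoTT}.

Lemma funext_idpath {A : Type} {fA : Fib A} {P : A -> Type} {fP : forall x, Fib (P x)}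
  (f : forall x, P x) : funext (fun x => idpath (x := f x)) == idpath.
Proof.
refine (_ @ funext_happly idpath); apply ap; apply funext; intros x; rewrite happly_1.
exact idpath.
Defined.

Definition psec {A : Type} {fA : Fib A} (a : A) (P : A -> Type) {fP : forall x, Fib (P x)}
  (u : P a) : Type := {s : forall x, P x & s a == u}.

#[export] Instance fib_psec {A : Type} {fA : Fib A} (a : A) (P : A -> Type)
  {fP : forall x, Fib (P x)} (u : P a) : Fib (psec a P u) := _.

Definition mk_psec {A : Type} {fA : Fib A} {a : A} {P : A -> Type}
  {fP : forall x, Fib (P x)} {u : P a} (s : forall x, P x) (e : s a == u) : psec a P u :=
  existT (fun s : forall x, P x => s a == u) s e.

Definition phtpy {A : Type} {fA : Fib A} {a : A} {P : A -> Type} {fP : forall x, Fib (P x)}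
  {u : P a} (s t : psec a P u) : Type :=
  psec a (fun x => projT1 s x == projT1 t x) (projT2 s @ inv (projT2 t)).

#[export] Instance fib_phtpy {A : Type} {fA : Fib A} {a : A} {P : A -> Type}
  {fP : forall x, Fib (P x)} {u : P a} (s t : psec a P u) : Fib (phtpy s t) :=
  fib_psec _ _ _.

Lemma htpy_ind {A : Type} {fA : Fib A} {P : A -> Type} {fP : forall x, Fib (P x)}
  {f : forall x, P x} (Q : forall g, (forall x, f x == g x) -> Type)
  {fQ : forall g h, Fib (Q g h)} (d : Q f (fun x => idpath)) {g} (h : forall x, f x == g x)
  : Q g h.
Proof.
refine (transport (Q g) (happly_funext h) _).
generalize (funext h); intros p; path_ind p.
refine (transport (Q f) _ d); apply funext; intros x; rewrite happly_1; exact idpath.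
Defined.

Definition phtpy_1 {A : Type} {fA : Fib A} {a : A} {P : A -> Type} {fP : forall x, Fib (P x)}
  {u : P a} (s : psec a P u) : phtpy s s := existT _ (fun x => idpath) (inv (concat_pV _)).

Lemma cancel_pV {A : Type} {fA : Fib A} {x y : A} {p q : x == y} (e : idpath == p @ inv q)
  : p == q.
Proof.
revert p e; path_ind q; intros p e.
rewrite inv_1, concat_p1 in e; exact (inv e).
Defined.

Definition eval {A : Type} {fA : Fib A} {a : A} {P : A -> Type} {fP : forall x, Fib (P x)}
  {u : P a} (x : A) : psec a P u -> P x := fun s => projT1 s x.

Definition path_phtpy_aux {A : Type} {fA : Fib A} {a : A} {P : A -> Type}
  {fP : forall x, Fib (P x)} {u : P a} (s t : psec a P u) (h : phtpy s t)
  : {p : s == t & forall x, ap (eval x) p == projT1 h x}.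
Proof.
destruct s as [s p], t as [t q], h as [h e]; cbn in h, e |- *.
revert q e.
refine (htpy_ind (fun t h => forall (q : t a == u) (e : h a == p @ inv q),
  {r : (existT _ s p : psec a P u) == existT _ t q & forall x, ap (eval x) r == h x}) _ h).
intros q e.
exists (ap (existT (fun s : forall x, P x => s a == u) s) (cancel_pV e)); intros x.
exact (inv (ap_compose (existT (fun s : forall x, P x => s a == u) s) (eval x)
  (cancel_pV e)) @ ap_const (s x) (cancel_pV e)).
Defined.

Definition path_phtpy {A : Type} {fA : Fib A} {a : A} {P : A -> Type}
  {fP : forall x, Fib (P x)} {u : P a} {s t : psec a P u} (h : phtpy s t) : s == t :=
  inv (projT1 (path_phtpy_aux s s (phtpy_1 s))) @ projT1 (path_phtpy_aux s t h).

Lemma path_phtpy_at {A : Type} {fA : Fib A} {a : A} {P : A -> Type}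
  {fP : forall x, Fib (P x)} {u : P a} {s t : psec a P u} (h : phtpy s t) (x : A)
  : ap (eval x) (path_phtpy h) == projT1 h x.
Proof.
refine (ap_pp _ _ _ @ ap2 concat (ap_V _ _ @ ap inv (projT2 (path_phtpy_aux s s _) x))
  (projT2 (path_phtpy_aux s t h) x) @ _).
cbn; rewrite inv_1; exact (concat_1p _).
Defined.

Definition phtpy_path {A : Type} {fA : Fib A} {a : A} {P : A -> Type}
  {fP : forall x, Fib (P x)} {u : P a} {s t : psec a P u} (p : s == t) : phtpy s t :=
  transport (phtpy s) p (phtpy_1 s).

Lemma phtpy_path_at {A : Type} {fA : Fib A} {a : A} {P : A -> Type}
  {fP : forall x, Fib (P x)} {u : P a} {s t : psec a P u} (p : s == t) (x : A)
  : projT1 (phtpy_path p) x == ap (eval x) p.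
Proof.
path_ind p; unfold phtpy_path; rewrite ap_1, transport_1; exact idpath.
Defined.

Lemma phtpy_path_K {A : Type} {fA : Fib A} {a : A} {P : A -> Type}
  {fP : forall x, Fib (P x)} {u : P a} {s t : psec a P u} (p : s == t)
  : path_phtpy (phtpy_path p) == p.
Proof.
path_ind p; unfold phtpy_path; rewrite transport_1; exact (concat_Vp _).
Defined.

(* For [k > 0] this expresses that the pointed type [A] is (k-1)-connected. *)
Definition elim_point {A : Type} {fA : Fib A} (k : nat) (a : A) : Type :=
  forall (P : A -> Type) (fP : forall x, Fib (P x)), (forall x, is_trunc k (P x)) ->
  forall u : P a, psec a P u.

Lemma psec_is_trunc {A : Type} {fA : Fib A} {k : nat} {a : A} (c : elim_point k a) (j : nat)
  : forall (P : A -> Type) (fP : forall x, Fib (P x)) (u : P a),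
    (forall x, is_trunc (j + k) (P x)) -> is_trunc j (psec a P u).
Proof.
induction j as [|j IH]; intros P fP u h.
- exists (c P fP h u); intros s.
  refine (path_phtpy (c _ _ (fun x => _) _)); apply is_trunc_S, h.
- intros s t.
  refine (is_trunc_retract j (phtpy s t) (s == t) _ _ path_phtpy phtpy_path phtpy_path_K _).
  apply IH; intros x; apply h.
Defined.

(* Pointed maps into a path type are equal as soon as the underlying maps are. *)
Lemma psec_loops_eq {A B : Type} {fA : Fib A} {fB : Fib B} {a : A} {b b' : B} {u : b == b'}
  (s t : psec a (fun _ => b == b') u) (h : forall x, projT1 s x == projT1 t x) : s == t.
Proof.
destruct s as [s p], t as [t q]; cbn in h.
pose (d := p @ inv q @ inv (h a)).
pose (m := fun (v l : b == b') => (v @ inv (s a)) @ l).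
pose (k := fun v => inv (concat_assoc v (inv (s a)) (s a)) @ ap (concat v) (concat_Vp (s a)) @ concat_p1' v
  : m v (s a) == v).
assert (n : forall l, m (s a) l == l)
  by exact (fun l => ap (fun r => r @ l) (concat_pV (s a)) @ concat_1p l).
pose (c := inv (n (s a)) @ ((k (s a) @ d @ inv (k (s a))) @ n (s a))).
apply path_phtpy.
exists (fun x => (inv (k (s x)) @ ap (m (s x)) c @ k (s x)) @ h x); cbn.
assert (e : ap (m (s a)) c == k (s a) @ d @ inv (k (s a))).
{ refine (inv (concat_p1' _) @ ap (concat _) (inv (concat_pV (n (s a)))) @ concat_assoc _ _ _ @ _).
  refine (ap (fun r => r @ inv (n (s a))) (ap_homotopy n c @ ap (concat _) (ap_id c)
    @ concat_p_Vp _ _) @ _).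
  refine (inv (concat_assoc _ _ _) @ ap (concat _) (concat_pV _) @ concat_p1' _). }
refine (ap (fun r => (inv (k (s a)) @ r @ k (s a)) @ h a) e @ _).
refine (ap (fun r => r @ h a) (_ : _ == d) @ _).
- refine (ap (concat _) (inv (concat_assoc _ _ _) @ ap (concat _)
    (inv (concat_assoc _ _ _) @ ap (concat d) (concat_Vp _))) @ concat_V_pp _ _ @ concat_p1' _).
- refine (inv (concat_assoc _ _ _) @ ap (concat p)
   (inv (concat_assoc _ _ _) @ ap (concat _) (concat_Vp _) @ concat_p1' _)).
Defined.
End Sections.

Section Recursors.
Context {T : HoTT}.

Lemma transport_const {A B : Type} {fA : Fib A} {fB : Fib B} {x y : A} (p : x == y) (b : B)
  : transport (fun _ => B) p b == b.
Proof. path_ind p; rewrite transport_1; exact idpath. Defined.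

Definition over_const {A B : Type} {fA : Fib A} {fB : Fib B} {x y : A} (p : x == y) {b b' : B}
  (l : b == b') : transport (fun _ => B) p b == b' := transport_const p b @ l.

Lemma ap_cast_over {A B : Type} {fA : Fib A} {fB : Fib B} (f : A -> B) {x y : A} (p : x == y)
  {b b' : B} (eb : f x = b) (eb' : f y = b') (l : b == b')
  (h : cast_over (P := fun _ => B) eb eb' (apD f p) == over_const p l)
  : ap f p == of_eq eb @ l @ inv (of_eq eb').
Proof.
destruct eb, eb'; cbn in *.
refine (_ @ inv (ap (fun r => idpath @ r) (ap (concat l) (of_eq inv_1) @ concat_p1' l) @ concat_1p l)).
refine (cancelL (transport_const p (f x)) _ _ (_ @ h)); clear h l.
path_ind p.
unfold apD; rewrite (J_idpath (fun y p => transport (fun _ => B) p (f x) == f y)).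
unfold transport_const; rewrite (J_idpath (fun y p => transport (fun _ => B) p (f x) == f x)).
rewrite ap_1, concat_p1.
unfold transport_1; destruct (transport_id (fun _ => B) x); exact idpath.
Defined.

Lemma apD_const {A B : Type} {fA : Fib A} {fB : Fib B} {x y : A} (p : x == y) (b : B)
  : apD (fun _ => b) p == transport_const p b.
Proof.
path_ind p.
unfold apD; rewrite (J_idpath (fun y p => transport (fun _ => B) p b == b)).
unfold transport_const; rewrite (J_idpath (fun y p => transport (fun _ => B) p b == b)).
unfold transport_1; destruct (transport_id (fun _ => B) x); exact idpath.
Defined.

Lemma over_concat_const {A B : Type} {fA : Fib A} {fB : Fib B} {x y z : A}
  (p : x == y) (q : y == z) {b b' b'' : B} (l : b == b') (l' : b' == b'')
  : over_concat (P := fun _ => B) (over_const p l) (over_const q l') == over_const (p @ q) (l @ l').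
Proof.
path_ind l'; path_ind l; rewrite concat_p1; unfold over_const; rewrite !concat_p1.
refine (ap2 over_concat (inv (apD_const p b)) (inv (apD_const q b)) @ _).
exact (apD_concat (fun _ => b) p q @ apD_const _ _).
Defined.

Lemma transport_over_const {A B : Type} {fA : Fib A} {fB : Fib B} {x y : A} {p q : x == y}
  (w : p == q) {b b' : B} (l : b == b')
  : transport (fun r => transport (fun _ => B) r b == b') w (over_const p l) == over_const q l.
Proof. path_ind w; rewrite transport_1; exact idpath. Defined.

Definition Trunc_rec (k : nat) {A B : Type} {fA : Fib A} {fB : Fib B} (h : is_trunc k B)
  (f : A -> B) : Trunc k A -> B := Trunc_ind k (fun _ => B) (fun _ => h) f.

Definition Trunc_rec_tr (k : nat) {A B : Type} {fA : Fib A} {fB : Fib B} (h : is_trunc k B)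
  (f : A -> B) (a : A) : Trunc_rec k h f (tr k a) = f a := Trunc_ind_tr k _ _ f a.

Definition Susp_rec {A B : Type} {fA : Fib A} {fB : Fib B} (n s : B) (m : A -> n == s)
  : Susp A -> B := Susp_ind (fun _ => B) n s (fun a => over_const (merid a) (m a)).

Definition Susp_rec_north {A B : Type} {fA : Fib A} {fB : Fib B} (n s : B)
  (m : A -> n == s) : Susp_rec n s m north = n := Susp_ind_north _ _ _ _.

Definition Susp_rec_south {A B : Type} {fA : Fib A} {fB : Fib B} (n s : B)
  (m : A -> n == s) : Susp_rec n s m south = s := Susp_ind_south _ _ _ _.

Lemma Susp_rec_merid {A B : Type} {fA : Fib A} {fB : Fib B} (n s : B) (m : A -> n == s) (a : A)
  : ap (Susp_rec n s m) (merid a)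
    == of_eq (Susp_rec_north n s m) @ m a @ inv (of_eq (Susp_rec_south n s m)).
Proof. exact (ap_cast_over _ _ _ _ _ (Susp_ind_merid _ _ _ _ a)). Defined.

Definition K1_rec {G : AbGroup} {B : Type} {fB : Fib B} (s : B) (l : G -> s == s)
  (w : forall g h, l g @ l h == l (g + h)) : K1 G -> B :=
  K1_ind (fun _ => B) s (fun g => over_const (loop g) (l g))
    (fun g h => ap (transport (fun r => transport (fun _ => B) r s == s) (loop_add g h)) (over_concat_const _ _ _ _ @ ap (over_const _) (w g h))
                @ transport_over_const _ _).

Definition K1_rec_star {G : AbGroup} {B : Type} {fB : Fib B} (s : B) (l : G -> s == s)
  (w : forall g h, l g @ l h == l (g + h)) : K1_rec s l w star = s := K1_ind_star _ _ _ _.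

Lemma K1_rec_loop {G : AbGroup} {B : Type} {fB : Fib B} (s : B) (l : G -> s == s)
  (w : forall g h, l g @ l h == l (g + h)) (g : G)
  : ap (K1_rec s l w) (loop g)
    == of_eq (K1_rec_star s l w) @ l g @ inv (of_eq (K1_rec_star s l w)).
Proof. exact (ap_cast_over _ _ _ _ _ (K1_ind_loop _ _ _ _ g)). Defined.
End Recursors.

Record pType {T : TypeFormers} := Build_pType {
  pcar :> Type;
  pfib : Fib pcar;
  ppt : pcar
}.
#[export] Existing Instance pfib.
Arguments Build_pType {_} pcar {pfib} ppt.
Arguments ppt {_} _.

Section PointedMaps.
Context {T : HoTT}.

Definition pmap (A B : pType) : Type := psec (ppt A) (fun _ => B) (ppt B).

Definition Build_pmap {A B : pType} (f : A -> B) (e : f (ppt A) == ppt B) : pmap A B :=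
  existT (fun f : A -> B => f (ppt A) == ppt B) f e.

Definition pmap_at {A B : pType} (y : A) (f : pmap A B) : B := projT1 f y.

Definition pmap_const (A B : pType) : pmap A B := Build_pmap (fun _ => ppt B) idpath.

Definition pmap_comp {A B C : pType} (g : pmap B C) (f : pmap A B) : pmap A C :=
  Build_pmap (fun x => projT1 g (projT1 f x)) (ap (projT1 g) (projT2 f) @ projT2 g).

Definition Omega (A : pType) : pType := Build_pType (ppt A == ppt A) idpath.

(* A pointed map into a loop space is the same as a loop at the constant pointed map. *)
Definition pmap_loop {A B : pType} (f : pmap A (Omega B)) : pmap_const A B == pmap_const A B :=
  path_phtpy (s := pmap_const A B) (t := pmap_const A B)
    (existT (fun h : A -> ppt B == ppt B => h (ppt A) == idpath @ inv idpath)
       (projT1 f) (projT2 f @ inv (concat_pV idpath))).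

Lemma pmap_loop_at {A B : pType} (f : pmap A (Omega B)) (x : A)
  : ap (eval x) (pmap_loop f) == projT1 f x.
Proof. exact (path_phtpy_at _ x). Defined.

Lemma pmap_loop_concat {A B : pType} (f g h : pmap A (Omega B))
  (e : forall x, projT1 f x @ projT1 g x == projT1 h x)
  : pmap_loop f @ pmap_loop g == pmap_loop h.
Proof.
refine (inv (phtpy_path_K _) @ ap path_phtpy _ @ phtpy_path_K _).
apply (psec_loops_eq (fA := pfib A) (b := ppt B) (b' := ppt B)
  (phtpy_path (pmap_loop f @ pmap_loop g)) (phtpy_path (pmap_loop h))); intros x.
refine (phtpy_path_at (pmap_loop f @ pmap_loop g) x @ _
  @ inv (phtpy_path_at (pmap_loop h) x)).
exact (ap_pp _ _ _ @ ap2 concat (pmap_loop_at f x) (pmap_loop_at g x) @ e x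
       @ inv (pmap_loop_at h x)).
Defined.
End PointedMaps.

Section EilenbergMacLane.
Context {T : HoTT}.

Fixpoint Kt (G : AbGroup) (n : nat) : pType :=
  match n with
  | O => Build_pType G (gzero G)
  | S n => match n with
           | O => Build_pType (K1 G) star
           | S _ => Build_pType (Susp (Kt G n)) north
           end
  end.

Definition K (G : AbGroup) (n : nat) : pType :=
  match n with
  | O => Build_pType G (gzero G)
  | S _ => Build_pType (Trunc (S (S n)) (Kt G n)) (tr _ (ppt (Kt G n)))
  end.

Lemma K_is_trunc (G : AbGroup) (n : nat) : is_trunc (S (S n)) (K G n).
Proof. destruct n as [|n]; [exact (gset G)|exact (Trunc_is_trunc _ _)]. Defined.

Lemma gadd_cancel {G : AbGroup} {x : G} (e : x + x == x) : x == gzero G.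
Proof.
refine (inv (gadd_0 _ x) @ ap (fun z => z + x) (inv (gadd_opp _ x)) @ _).
exact (inv (gadd_assoc _ _ _ _) @ ap (gadd (gopp x)) e @ gadd_opp _ x).
Defined.

Lemma hom_0 {G H : AbGroup} (phi : Hom G H) : phi (gzero G) == gzero H.
Proof.
exact (gadd_cancel (inv (hom_add phi _ _) @ ap phi (gadd_0 _ _))).
Defined.

Lemma loop_0 (G : AbGroup) : loop (gzero G) == idpath.
Proof.
refine (cancelL (loop (gzero G)) _ _ (loop_add _ _ @ ap loop (gadd_0 _ _) @ inv (concat_p1' _))).
Defined.

Fixpoint Kt_map {G H : AbGroup} (phi : Hom G H) (n : nat) : pmap (Kt G n) (Kt H n) :=
  match n with
  | O => Build_pmap (A := Kt G 0) (B := Kt H 0) (hom_fun phi) (hom_0 phi)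
  | S n =>
    match n return pmap (Kt G n) (Kt H n) -> pmap (Kt G (S n)) (Kt H (S n)) with
    | O => fun _ =>
      Build_pmap (A := Kt G 1) (B := Kt H 1) (K1_rec star (fun g => loop (phi g))
                  (fun g h => loop_add _ _ @ ap loop (inv (hom_add phi g h))))
               (of_eq (K1_rec_star _ _ _))
    | S n => fun f =>
      Build_pmap (A := Kt G (S (S n))) (B := Kt H (S (S n)))
         (Susp_rec north south (fun x => merid (projT1 f x)))
               (of_eq (Susp_rec_north _ _ _))
    end (Kt_map phi n)
  end.

Definition K_map {G H : AbGroup} (phi : Hom G H) (n : nat) : pmap (K G n) (K H n) :=
  match n with
  | O => Build_pmap (A := K G 0) (B := K H 0) (hom_fun phi) (hom_0 phi)
  | S m =>
    Build_pmap (A := K G (S m)) (B := K H (S m)) (Trunc_rec (S (S (S m))) (Trunc_is_trunc _ _)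
                (fun x => tr _ (projT1 (Kt_map phi (S m)) x)))
             (of_eq (Trunc_rec_tr _ _ (fun x => tr _ (projT1 (Kt_map phi (S m)) x)) _)
       @ ap (tr _) (projT2 (Kt_map phi (S m))))
  end.

Definition sigma_raw (G : AbGroup) (n : nat)
  : Kt G n -> ppt (Kt G (S n)) == ppt (Kt G (S n)) :=
  match n with
  | O => loop
  | S _ => fun x => merid x @ inv (merid (ppt _))
  end.

Lemma sigma_raw_0 (G : AbGroup) (n : nat) : sigma_raw G n (ppt (Kt G n)) == idpath.
Proof. destruct n as [|n]; [exact (loop_0 G)|exact (concat_pV _)]. Defined.

Definition sigma_tr (G : AbGroup) (n : nat) (x : Kt G n) : Omega (K G (S n)) :=
  ap (tr _) (sigma_raw G n x).

Lemma sigma_tr_0 (G : AbGroup) (n : nat) : sigma_tr G n (ppt (Kt G n)) == idpath.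
Proof. exact (ap (ap (tr _)) (sigma_raw_0 G n) @ of_eq (ap_1 _)). Defined.

Definition sigma (G : AbGroup) (n : nat) : pmap (K G n) (Omega (K G (S n))) :=
  match n with
  | O => Build_pmap (A := K G 0) (B := Omega (K G 1)) (sigma_tr G 0) (sigma_tr_0 G 0)
  | S m =>
    Build_pmap (A := K G (S m)) (B := Omega (K G (S (S m))))
      (Trunc_rec (S (S (S m))) (K_is_trunc G (S (S m)) _ _) (sigma_tr G (S m)))
             (of_eq (Trunc_rec_tr _ _ (sigma_tr G (S m)) _) @ sigma_tr_0 G (S m))
  end.

Lemma Kt_elim_point (G : AbGroup) (n : nat) : elim_point n (ppt (Kt G n)).
Proof.
induction n as [|[|n] IH]; intros P fP h u.
- exact (mk_psec (fun x => projT1 (h x)) (projT2 (h _) u)).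
- unshelve refine (mk_psec (K1_ind P u (fun g => projT1 (h star _ _)) _)
    (of_eq (K1_ind_star _ _ _ _))).
  intros g g'; exact (projT1 (contr_paths (h star _ _) _ _)).
- pose (v := transport P (merid (ppt (Kt G (S n)))) u).
  destruct (IH (fun x => transport P (merid x) u == v) _ (fun x => h south _ _) idpath) as [m _].
  exact (mk_psec (Susp_ind P u v m) (of_eq (Susp_ind_north _ _ _ _))).
Defined.

Lemma K_elim_point (G : AbGroup) (n : nat) : elim_point n (ppt (K G n)).
Proof.
destruct n as [|n]; [exact (Kt_elim_point G 0)|]; intros P fP h u.
destruct (Kt_elim_point G (S n) (fun x => P (tr _ x)) _ (fun x => h _) u) as [s e].
refine (mk_psec (Trunc_ind _ P (fun x => is_trunc_add 2 _ _ _ (h x)) s) (of_eq _ @ e)).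
apply Trunc_ind_tr.
Defined.

Lemma pmap_K_is_trunc (G H : AbGroup) (n m : nat)
  : is_trunc (S (S n)) (pmap (K G m) (K H (n + m))).
Proof. exact (psec_is_trunc (K_elim_point G m) (S (S n)) (fun _ => K H (n + m)) _ _ (fun _ => K_is_trunc H (n + m))). Defined.

Lemma KtS_ind (G : AbGroup) (n : nat) (P : Kt G (S n) -> Type) (fP : forall x, Fib (P x))
  (h : forall x, is_trunc (S (S n)) (P x)) (u : P (ppt (Kt G (S n))))
  (l : forall x, transport P (sigma_raw G n x) u == u) : forall x, P x.
Proof.
destruct n as [|n].
- refine (K1_ind P u l _); intros g g'; exact (projT1 (h star _ _ _ _)).
- refine (Susp_ind P u (transport P (merid (ppt (Kt G (S n)))) u) (fun a => _)).
  refine (inv (transport_pV P (merid (ppt _)) _) @ ap (transport P (merid (ppt _))) _).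
  exact (inv (transport_pp _ _ _ _) @ l a).
Defined.

Lemma conj_concat {A : Type} {fA : Fib A} {x y z w : A} (e : x == z) (f : y == w)
  (p q : z == w) : (e @ p @ inv f) @ inv (e @ q @ inv f) == e @ (p @ inv q) @ inv e.
Proof.
revert p q; path_ind f; path_ind e; intros p q; rewrite !inv_1, !concat_p1.
refine (ap2 (fun r r' => r @ inv r') (concat_1p p) (concat_1p q) @ inv (concat_1p _)).
Defined.

Lemma ap_Kt_map {G H : AbGroup} (phi : Hom G H) (n : nat) (x : Kt G n)
  : ap (projT1 (Kt_map phi (S n))) (sigma_raw G n x)
    == projT2 (Kt_map phi (S n)) @ sigma_raw H n (projT1 (Kt_map phi n) x)
         @ inv (projT2 (Kt_map phi (S n))).
Proof.
destruct n as [|n]; [exact (K1_rec_loop _ _ _ x)|].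
pose (f := projT1 (Kt_map phi (S n))); pose (m := fun x => merid (f x) : north == south).
change (ap (Susp_rec north south m) (merid x @ inv (merid (ppt _)))
  == of_eq (Susp_rec_north _ _ m) @ (m x @ inv (merid (ppt _)))
  @ inv (of_eq (Susp_rec_north _ _ m))).
refine (ap_pp _ _ _ @ ap2 concat (Susp_rec_merid _ _ m x)
  (ap_V _ _ @ ap inv (Susp_rec_merid _ _ m _)) @ _).
assert (e : m (ppt (Kt G (S n))) == merid (ppt (Kt H (S n))))
  by exact (ap merid (projT2 (Kt_map phi (S n)))).
refine (ap (fun r => (of_eq _ @ m x @ inv (of_eq _)) @ inv (of_eq _ @ r @ inv (of_eq _))) e @ _).
exact (conj_concat _ _ _ _).
Defined.

Lemma concat_loops {A : Type} {fA : Fib A} {a : A} {c a1 a2 a3 : a == a} (d : idpath == c)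
  (e1 : c == a1) (e2 : c == a2) (e3 : c == a3)
  : {u : a1 @ a2 == a3 & forall S1 S2 S3 : c == c, S1 @ S2 == S3 ->
      u @ (inv e3 @ S3 @ e3) == ap2 concat (inv e1 @ S1 @ e1) (inv e2 @ S2 @ e2) @ u}.
Proof.
path_ind e1; path_ind e2; path_ind e3; path_ind d.
exists (concat_1p idpath); intros S1 S2 S3 e.
rewrite inv_1, (concat_p1 S1), (concat_p1 S2), (concat_p1 S3).
refine (ap (concat _) (concat_1p S3 @ inv e) @ _ @
  ap (fun r => r @ concat_1p idpath) (ap2 (ap2 concat) (inv (concat_1p S1)) (inv (concat_1p S2)))).
unfold ap2.
refine (_ @ concat_assoc _ _ _).
assert (f2 : ap (concat idpath) S2 @ concat_1p idpath == concat_1p idpath @ S2)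
  by exact (ap_homotopy concat_1p S2 @ ap (concat _) (ap_id S2)).
assert (f1 : ap (fun r => r @ idpath) S1 @ concat_1p idpath == concat_1p idpath @ S1).
{ assert (k : concat_1p (@idpath _ _ _ a) == concat_p1' idpath).
  { unfold concat_1p, concat_p1'.
    rewrite (J_idpath (fun y p => idpath (x := a) @ p == p)); exact idpath. }
  refine (ap (concat _) k @ ap_homotopy concat_p1' S1 @ ap2 concat (inv k) (ap_id S1)). }
exact (concat_assoc _ _ _ @ ap (fun r => r @ S2) (inv f1) @ inv (concat_assoc _ _ _)
  @ ap (concat _) (inv f2)).
Defined.

Lemma ap_ap2 {A B C D : Type} {fA : Fib A} {fB : Fib B} {fC : Fib C} {fD : Fib D}
  (m : B -> C -> D) (f : A -> B) (g : A -> C) {x y : A} (p : x == y)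
  : ap (fun x => m (f x) (g x)) p == ap2 m (ap f p) (ap g p).
Proof. path_ind p; unfold ap2; rewrite !ap_1, concat_p1; exact idpath. Defined.

Lemma inv_V {A : Type} {fA : Fib A} {x y : A} (p : x == y) : inv (inv p) == p.
Proof. path_ind p; rewrite !inv_1; exact idpath. Defined.

Lemma conj_mul {A : Type} {fA : Fib A} {x y : A} (h : x == y) (p q : y == y)
  : (h @ p @ inv h) @ (h @ q @ inv h) == h @ (p @ q) @ inv h.
Proof.
revert p q; path_ind h; intros p q; rewrite !inv_1, !concat_p1.
exact (ap2 concat (concat_1p p) (concat_1p q) @ inv (concat_1p _)).
Defined.

Lemma ap_conj {A B : Type} {fA : Fib A} {fB : Fib B} (f : A -> B) {x y : A} (h : x == y)
  (p : y == y) : ap f (h @ p @ inv h) == ap f h @ ap f p @ inv (ap f h).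
Proof. exact (ap_pp _ _ _ @ ap (concat _) (ap_pp _ _ _ @ ap (concat _) (ap_V _ _))). Defined.

Lemma ap_conj3 {A B : Type} {fA : Fib A} {fB : Fib B} (f : A -> B) {x y z w : A} (h : x == y)
  (p : y == z) (h' : w == z) : ap f (h @ p @ inv h') == ap f h @ ap f p @ inv (ap f h').
Proof. exact (ap_pp _ _ _ @ ap (concat _) (ap_pp _ _ _ @ ap (concat _) (ap_V _ _))). Defined.

Lemma ap_sigma_tr (G : AbGroup) (n : nat)
  : {h : sigma_tr G (S n) (ppt _) == projT1 (sigma G (S n)) (ppt _) &
     forall x, ap (sigma_tr G (S n)) (sigma_raw G n x)
               == h @ ap (projT1 (sigma G (S n))) (sigma_tr G n x) @ inv h}.
Proof.
pose (h := fun x => inv (of_eq (Trunc_rec_tr (S (S (S n))) (K_is_trunc G (S (S n)) _ _)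
  (sigma_tr G (S n)) x))).
exists (h (ppt _)); intros x.
refine (inv (concat_p1' _) @ ap (concat _) (inv (concat_pV (h (ppt _)))) @ concat_assoc _ _ _ @ _).
refine (ap (fun r => r @ inv (h (ppt _))) (ap_homotopy h (sigma_raw G n x)) @ inv (concat_assoc _ _ _) @ _).
exact (ap (fun r => h (ppt _) @ r @ inv (h (ppt _))) (ap_compose (tr _) (projT1 (sigma G (S n))) (sigma_raw G n x))).
Defined.

Lemma sigma_tr_add {G H : AbGroup} (phi psi chi : Hom G H)
  (e : forall g, phi g + psi g == chi g) (n : nat)
  : forall x : Kt G n,
    sigma_tr H n (projT1 (Kt_map phi n) x) @ sigma_tr H n (projT1 (Kt_map psi n) x)
    == sigma_tr H n (projT1 (Kt_map chi n) x).
Proof.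
induction n as [|n IH].
- intros g; exact (inv (ap_pp _ _ _) @ ap (ap (tr _)) (loop_add _ _ @ ap loop (e g))).
- pose (F := fun (phi : Hom G H) x => sigma_tr H (S n) (projT1 (Kt_map phi (S n)) x)).
  pose (E := fun phi : Hom G H => inv (ap (sigma_tr H (S n)) (projT2 (Kt_map phi (S n))))).
  pose (L := fun y => ap (sigma_tr H (S n)) (sigma_raw H n y)).
  assert (hF : forall phi x, ap (F phi) (sigma_raw G n x)
     == inv (E phi) @ L (projT1 (Kt_map phi n) x) @ E phi).
  { intros phi' x.
    refine (ap_compose (projT1 (Kt_map phi' _)) (sigma_tr H _) _ @ ap (ap _) (ap_Kt_map phi' n x) @ _).
    refine (ap_conj _ _ _ @ ap (fun r => r @ _) (inv (inv_V _))). }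
  destruct (concat_loops (inv (sigma_tr_0 H _)) (E phi) (E psi) (E chi)) as [u hu].
  refine (KtS_ind G n (fun x => F phi x @ F psi x == F chi x) _ (fun x => K_is_trunc H (S (S n)) _ _ _ _) u _).
  intros x; apply (transport_eq (fun x => F phi x @ F psi x) (F chi)).
  refine (ap (concat u) (hF chi x) @ hu (L (projT1 (Kt_map phi n) x)) (L (projT1 (Kt_map psi n) x)) _ _
    @ ap (fun r => r @ u) (ap2 (ap2 concat) (inv (hF phi x)) (inv (hF psi x)) @
        inv (ap_ap2 concat (F phi) (F psi) (sigma_raw G n x)))).
  destruct (ap_sigma_tr H n) as [h hh].
  refine (ap2 concat (hh _) (hh _) @ conj_mul _ _ _ @ ap (fun r => h @ r @ inv h) _ @ inv (hh _)).
  exact (inv (ap_pp _ _ _) @ ap (ap _) (IH x)).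
Defined.

Lemma sigma_add {G H : AbGroup} (phi psi chi : Hom G H)
  (e : forall g, phi g + psi g == chi g) (n : nat) (x : K G n)
  : projT1 (sigma H n) (projT1 (K_map phi n) x) @ projT1 (sigma H n) (projT1 (K_map psi n) x)
    == projT1 (sigma H n) (projT1 (K_map chi n) x).
Proof.
destruct n as [|n]; [exact (sigma_tr_add phi psi chi e 0 x)|].
revert x; refine (Trunc_ind _ _ (fun x => is_trunc_S (S (S n)) _ _ _) _).
{ exact (K_is_trunc H (S (S n)) _ _ _ _). }
intros x.
assert (h : forall phi : Hom G H, projT1 (sigma H (S n)) (projT1 (K_map phi (S n)) (tr _ x))
  == sigma_tr H (S n) (projT1 (Kt_map phi (S n)) x)).
{ intros phi'.
  exact (ap (projT1 (sigma H (S n)))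
           (of_eq (Trunc_rec_tr _ _ (fun x => tr _ (projT1 (Kt_map phi' (S n)) x)) x))
         @ of_eq (Trunc_rec_tr _ _ (sigma_tr H (S n)) _)). }
exact (ap2 concat (h phi) (h psi) @ sigma_tr_add phi psi chi e (S n) x @ inv (h chi)).
Defined.

Lemma conj_conj {A : Type} {fA : Fib A} {x y z : A} (p : x == y) (q : y == z) (r : z == z)
  : p @ (q @ r @ inv q) @ inv p == (p @ q) @ r @ inv (p @ q).
Proof.
revert r; path_ind q; path_ind p; intros r; rewrite !concat_p1, !inv_1, !concat_p1.
exact (concat_1p _).
Defined.

Lemma sigma_tr_eq (G : AbGroup) (n : nat) (x y : Kt G (S n))
  (e : tr (S (S (S n))) x == tr (S (S (S n))) y) : sigma_tr G (S n) x == sigma_tr G (S n) y.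
Proof.
refine (inv (of_eq (Trunc_rec_tr _ _ (sigma_tr G (S n)) x)) @ _
  @ of_eq (Trunc_rec_tr _ _ (sigma_tr G (S n)) y)).
exact (ap (projT1 (sigma G (S n))) e).
Defined.

Lemma Kt_map_K {G H : AbGroup} (phi : Hom G H) (psi : Hom H G) (e : forall g, psi (phi g) == g)
  (n : nat) : forall x : Kt G (S n),
  tr (S (S (S n))) (projT1 (Kt_map psi (S n)) (projT1 (Kt_map phi (S n)) x)) == tr _ x.
Proof.
assert (step : forall n, (forall x : Kt G n,
    sigma_tr G n (projT1 (Kt_map psi n) (projT1 (Kt_map phi n) x)) == sigma_tr G n x) ->
  forall x : Kt G (S n),
    tr (S (S (S n))) (projT1 (Kt_map psi (S n)) (projT1 (Kt_map phi (S n)) x)) == tr _ x).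
{ clear n; intros n IH.
  pose (f := projT1 (Kt_map phi (S n))); pose (g := projT1 (Kt_map psi (S n))).
  pose (p := ap g (projT2 (Kt_map phi (S n))) @ projT2 (Kt_map psi (S n))).
  refine (KtS_ind G n (fun x => tr _ (g (f x)) == tr _ x) _ (fun x => K_is_trunc G (S n) _ _)
    (ap (tr _) p) _).
  intros x; apply (transport_eq (fun x => tr _ (g (f x))) (tr _)).
  assert (h : ap (fun x => g (f x)) (sigma_raw G n x)
    == p @ sigma_raw G n (projT1 (Kt_map psi n) (projT1 (Kt_map phi n) x)) @ inv p).
  { refine (ap_compose f g _ @ ap (ap g) (ap_Kt_map phi n x) @ ap_conj _ _ _ @ _).
    exact (ap (fun r => _ @ r @ _) (ap_Kt_map psi n _) @ conj_conj _ _ _). }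
  refine (_ @ ap (fun r => r @ ap (tr _) p)
    (inv (ap_compose (fun x => g (f x)) (tr _) (sigma_raw G n x) @ ap (ap (tr _)) h @ ap_conj _ _ _))).
  refine (ap (concat _) (inv (IH x)) @ inv (_ @ _)).
  - exact (inv (concat_assoc _ _ _) @ ap (concat _) (inv (concat_assoc _ _ _) @ ap (concat _) (concat_Vp _))).
  - exact (ap (concat _) (concat_p1' _)). }
induction n as [|n IH]; apply step; intros x.
- exact (ap (sigma_tr G 0) (e x)).
- exact (sigma_tr_eq G n _ _ (IH x)).
Defined.

Lemma K_map_K {G H : AbGroup} (phi : Hom G H) (psi : Hom H G) (e : forall g, psi (phi g) == g)
  (n : nat) : forall x : K G n, projT1 (K_map psi n) (projT1 (K_map phi n) x) == x.
Proof.
destruct n as [|n]; [exact e|].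
refine (Trunc_ind _ _ (fun x => is_trunc_S (S (S n)) _ _ _) _).
{ exact (K_is_trunc G (S n) _ _). }
intros x.
refine (_ @ Kt_map_K phi psi e n x).
refine (ap (projT1 (K_map psi (S n)))
  (of_eq (Trunc_rec_tr _ _ (fun x => tr _ (projT1 (Kt_map phi (S n)) x)) x)) @ _).
exact (of_eq (Trunc_rec_tr _ _ (fun x => tr _ (projT1 (Kt_map psi (S n)) x)) _)).
Defined.

End EilenbergMacLane.

Section CupProduct.
Context {T : HoTT}.

Definition pure_hom {G H : AbGroup} (g : G) : Hom H (tensor G H) :=
  {| hom_fun := pure g; hom_add := pure_addr g |}.

Definition cup_0 (G H : AbGroup) (m : nat) (g : G) : pmap (K H m) (K (tensor G H) m) :=
  K_map (pure_hom g) m.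

(* The path constructors are sent to loops at the constant pointed map, given by the
   pointed maps [sigma o (a cup -)] into loop spaces; [cup_raw_loop] and [cup_raw_merid]
   compute the resulting action on paths for a fixed second factor. *)
Definition cup_1 (G H : AbGroup) (m : nat) : K1 G -> pmap (K H m) (K (tensor G H) (S m)) :=
  K1_rec (pmap_const (K H m) (K (tensor G H) (S m)))
    (fun g => pmap_loop (pmap_comp (sigma (tensor G H) m) (cup_0 G H m g)))
    (fun g g' => pmap_loop_concat (A := K H m) (B := K (tensor G H) (S m))
       (pmap_comp (sigma _ m) (cup_0 G H m g)) (pmap_comp (sigma _ m) (cup_0 G H m g'))
       (pmap_comp (sigma _ m) (cup_0 G H m (g + g')))
       (sigma_add (pure_hom g) (pure_hom g') (pure_hom (g + g'))
          (fun h => inv (pure_addl g g' h)) m)).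

Fixpoint cup_raw (G H : AbGroup) (m n : nat)
  : Kt G n -> pmap (K H m) (K (tensor G H) (n + m)) :=
  match n with
  | O => cup_0 G H m
  | S n =>
    match n return (Kt G n -> pmap (K H m) (K (tensor G H) (n + m))) ->
      Kt G (S n) -> pmap (K H m) (K (tensor G H) (S n + m)) with
    | O => fun _ => cup_1 G H m
    | S n => fun cup =>
      Susp_rec (pmap_const _ _) (pmap_const _ _)
        (fun a => pmap_loop (pmap_comp (sigma (tensor G H) (S n + m)) (cup a)))
    end (cup_raw G H m n)
  end.

Definition cup {G H : AbGroup} {n m : nat}
  : K G n -> pmap (K H m) (K (tensor G H) (n + m)) :=
  match n return K G n -> pmap (K H m) (K (tensor G H) (n + m)) with
  | O => cup_raw G H m 0
  | S n => Trunc_rec (S (S (S n))) (pmap_K_is_trunc H (tensor G H) (S n) m) (cup_raw G H m (S n))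
  end.

Definition cup_raw_star (G H : AbGroup) (m : nat) : cup_raw G H m 1 star = pmap_const _ _ :=
  K1_rec_star _ _ _.

Definition cup_raw_north (G H : AbGroup) (m n : nat)
  : cup_raw G H m (S (S n)) north = pmap_const _ _ := Susp_rec_north _ _ _.

Definition cup_raw_south (G H : AbGroup) (m n : nat)
  : cup_raw G H m (S (S n)) south = pmap_const _ _ := Susp_rec_south _ _ _.

Lemma cup_raw_loop (G H : AbGroup) (m : nat) (y : K H m) (g : G)
  : ap (fun x => pmap_at y (cup_raw G H m 1 x)) (loop g)
    == ap (pmap_at y) (of_eq (cup_raw_star G H m))
       @ pmap_at (B := Omega _) (pmap_at y (cup_raw G H m 0 g)) (sigma (tensor G H) m)
       @ inv (ap (pmap_at y) (of_eq (cup_raw_star G H m))).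
Proof.
refine (ap_compose (cup_raw G H m 1) (pmap_at y) (loop g)
  @ ap (ap (pmap_at y)) (K1_rec_loop _ _ _ g) @ ap_conj3 (pmap_at y) _ _ _ @ _).
exact (ap (fun r => _ @ r @ _)
  (pmap_loop_at (pmap_comp (sigma (tensor G H) m) (cup_0 G H m g)) y)).
Defined.

Lemma cup_raw_merid (G H : AbGroup) (m n : nat) (y : K H m) (a : Kt G (S n))
  : ap (fun x => pmap_at y (cup_raw G H m (S (S n)) x)) (merid a)
    == ap (pmap_at y) (of_eq (cup_raw_north G H m n))
       @ pmap_at (B := Omega _) (pmap_at y (cup_raw G H m (S n) a)) (sigma (tensor G H) (S n + m))
       @ inv (ap (pmap_at y) (of_eq (cup_raw_south G H m n))).
Proof.
refine (ap_compose (cup_raw G H m (S (S n))) (pmap_at y) (merid a)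
  @ ap (ap (pmap_at y)) (Susp_rec_merid _ _ _ a) @ ap_conj3 (pmap_at y) _ _ _ @ _).
exact (ap (fun r => _ @ r @ _)
  (pmap_loop_at (pmap_comp (sigma (tensor G H) (S n + m)) (cup_raw G H m (S n) a)) y)).
Defined.

Definition hom_id (G : AbGroup) : Hom G G :=
  {| hom_fun := fun x => x; hom_add := fun x y => idpath |}.

Definition hom_comp {G H L : AbGroup} (f' : Hom H L) (f : Hom G H) : Hom G L :=
  {| hom_fun := fun x => f' (f x);
     hom_add := fun x y => ap f' (hom_add f x y) @ hom_add f' _ _ |}.

Definition hom_plus {G H : AbGroup} (f f' : Hom G H) : Hom G H.
Proof.
exists (fun x => f x + f' x); intros x y.
refine (ap2 gadd (hom_add f x y) (hom_add f' x y) @ inv (gadd_assoc _ _ _ _) @ _).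
refine (ap (gadd (f x)) _ @ gadd_assoc _ _ _ _).
refine (gadd_assoc _ _ _ _ @ ap (fun r => r + f' y) (gadd_comm _ _ _) @ inv (gadd_assoc _ _ _ _)).
Defined.

Definition pure_hom_l {G H : AbGroup} (h : H) : Hom G (tensor G H) :=
  {| hom_fun := fun g => pure g h; hom_add := fun g g' => pure_addl g g' h |}.

Section Associativity.
Context (G1 G2 G3 : AbGroup).

Definition assoc_l (z : G3) : Hom (tensor G1 G2) (tensor G1 (tensor G2 G3)) :=
  tensor_rec (fun x y => pure x (pure y z))
    (fun x x' y => pure_addl x x' (pure y z))
    (fun x y y' => ap (pure x) (pure_addl y y' z) @ pure_addr x _ _).

Definition assoc_l_pure (z : G3) (x : G1) (y : G2)
  : assoc_l z (pure x y) == pure x (pure y z) := tensor_rec_pure _ _ _ x y.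

(* The associativity isomorphism, characterised by [tensor_assoc_pure]. *)
Definition tensor_assoc : Hom (tensor (tensor G1 G2) G3) (tensor G1 (tensor G2 G3)).
Proof.
refine (tensor_rec (fun t z => assoc_l z t) (fun t t' z => hom_add (assoc_l z) t t') _).
intros t z z'; refine (tensor_ext _ (hom_plus (assoc_l z) (assoc_l z')) _ t); intros x y.
refine (assoc_l_pure _ x y @ ap (pure x) (pure_addr y z z') @ pure_addr x _ _ @ _).
exact (ap2 gadd (inv (assoc_l_pure z x y)) (inv (assoc_l_pure z' x y))).
Defined.

Lemma tensor_assoc_pure (x : G1) (y : G2) (z : G3)
  : tensor_assoc (pure (pure x y) z) == pure x (pure y z).
Proof. exact (tensor_rec_pure _ _ _ _ _ @ assoc_l_pure z x y). Defined.

Definition assoc_r (x : G1) : Hom (tensor G2 G3) (tensor (tensor G1 G2) G3) :=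
  tensor_rec (fun y z => pure (pure x y) z)
    (fun y y' z => ap (fun t => pure t z) (pure_addr x y y') @ pure_addl _ _ z)
    (fun y z z' => pure_addr _ z z').

Definition assoc_r_pure (x : G1) (y : G2) (z : G3)
  : assoc_r x (pure y z) == pure (pure x y) z := tensor_rec_pure _ _ _ y z.

Definition tensor_assoc_inv : Hom (tensor G1 (tensor G2 G3)) (tensor (tensor G1 G2) G3).
Proof.
refine (tensor_rec (fun x t => assoc_r x t) _ (fun x t t' => hom_add (assoc_r x) t t')).
intros x x' t; refine (tensor_ext _ (hom_plus (assoc_r x) (assoc_r x')) _ t); intros y z.
refine (assoc_r_pure _ y z @ ap (fun t => pure t z) (pure_addl x x' y) @ pure_addl _ _ z @ _).
exact (ap2 gadd (inv (assoc_r_pure x y z)) (inv (assoc_r_pure x' y z))).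
Defined.

Lemma tensor_assoc_inv_pure (x : G1) (y : G2) (z : G3)
  : tensor_assoc_inv (pure x (pure y z)) == pure (pure x y) z.
Proof. exact (tensor_rec_pure _ _ _ _ _ @ assoc_r_pure x y z). Defined.

Lemma tensor_assocK (t : tensor (tensor G1 G2) G3) : tensor_assoc_inv (tensor_assoc t) == t.
Proof.
refine (tensor_ext (hom_comp tensor_assoc_inv tensor_assoc) (hom_id _) _ t); intros s z.
refine (tensor_ext (hom_comp (hom_comp tensor_assoc_inv tensor_assoc) (pure_hom_l z))
  (pure_hom_l z) _ s); intros x y.
exact (ap tensor_assoc_inv (tensor_assoc_pure x y z) @ tensor_assoc_inv_pure x y z).
Defined.

Lemma tensor_assoc_invK (t : tensor G1 (tensor G2 G3)) : tensor_assoc (tensor_assoc_inv t) == t.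
Proof.
refine (tensor_ext (hom_comp tensor_assoc tensor_assoc_inv) (hom_id _) _ t); intros x s.
refine (tensor_ext (hom_comp (hom_comp tensor_assoc tensor_assoc_inv) (pure_hom x))
  (pure_hom x) _ s); intros y z.
exact (ap tensor_assoc (tensor_assoc_inv_pure x y z) @ tensor_assoc_pure x y z).
Defined.

End Associativity.

Fixpoint add_assoc (n m k : nat) : ((n + m) + k = n + (m + k))%nat :=
  match n with
  | O => eq_refl
  | S n => f_equal S (add_assoc n m k)
  end.

Definition alpha_star (G1 G2 G3 : AbGroup) (n m k : nat)
  (x : K (tensor (tensor G1 G2) G3) (n + m + k))
  : K (tensor G1 (tensor G2 G3)) (n + (m + k)) :=
  eq_rect (n + m + k)%nat (fun i => K (tensor G1 (tensor G2 G3)) i)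
    (projT1 (K_map (tensor_assoc G1 G2 G3) (n + m + k)) x) (n + (m + k))%nat (add_assoc n m k).

Definition alpha_star_inv (G1 G2 G3 : AbGroup) (n m k : nat)
  (x : K (tensor G1 (tensor G2 G3)) (n + (m + k)))
  : K (tensor (tensor G1 G2) G3) (n + m + k) :=
  projT1 (K_map (tensor_assoc_inv G1 G2 G3) (n + m + k))
    (eq_rect (n + (m + k))%nat (fun i => K (tensor G1 (tensor G2 G3)) i) x
       (n + m + k)%nat (eq_sym (add_assoc n m k))).

Lemma alpha_starK (G1 G2 G3 : AbGroup) (n m k : nat) x
  : alpha_star_inv G1 G2 G3 n m k (alpha_star G1 G2 G3 n m k x) == x.
Proof.
unfold alpha_star, alpha_star_inv; destruct (add_assoc n m k); cbn.
exact (K_map_K _ _ (tensor_assocK G1 G2 G3) _ x).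
Defined.

Lemma alpha_star_invK (G1 G2 G3 : AbGroup) (n m k : nat) x
  : alpha_star G1 G2 G3 n m k (alpha_star_inv G1 G2 G3 n m k x) == x.
Proof.
unfold alpha_star, alpha_star_inv; destruct (add_assoc n m k); cbn.
exact (K_map_K _ _ (tensor_assoc_invK G1 G2 G3) _ x).
Defined.

Definition smile {G H : AbGroup} {n m : nat} (x : K G n) (y : K H m) : K (tensor G H) (n + m) :=
  pmap_at y (cup x).

End CupProduct.

Notation "x \smile y" := (smile x y) (at level 50, left associativity).

(* Main.v *)
Require Import Defs.

(* Let [E] be a pointed (n+1)-type.  A pointed map [f] from [K G (n+1)] to [E] is determined by
   the loops [Omega f (sigma w)], [w : K G n] ([K_ext]), and a loop in a type of pointed maps is
   determined by its values ([loops_ext]).  As [Omega (- cup y)] sends [sigma w] to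
   [sigma (w cup y)] and [Omega (K_map phi)] sends it to [sigma (K_map phi w)], both sides of the
   theorem, regarded as pointed maps from [K G1 (n+1)] to
   [K G2 m ->* (K G3 k ->* K L (n+1+(m+k)))], act on [sigma w] by [sigma] of the two sides at
   [w], and an induction on [n] applies.  Only pointwise equality at [n] is used, so the
   homogeneity of Eilenberg-MacLane spaces plays no role.  The case [n = 0] is the naturality
   of the cup product in its first argument, proved in the same way by induction on [m]. *)

Section Loops.
Context {T : HoTT}.

(** * Pointed mapping types and the action of pointed maps on loops *)

Definition PM (A B : pType) : pType := Build_pType (pmap A B) (pmap_const A B).

Definition loops_map {A B : pType} (f : pmap A B) (p : Omega A) : Omega B :=
  inv (projT2 f) @ ap (projT1 f) p @ projT2 f.

Lemma inv_pp {A : Type} {fA : Fib A} {x y z : A} (p : x == y) (q : y == z)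
  : inv (p @ q) == inv q @ inv p.
Proof. path_ind q; rewrite inv_1, !concat_p1; exact (inv (concat_1p _)). Defined.

Lemma loops_map_comp {A B C : pType} (g : pmap B C) (f : pmap A B) (p : Omega A)
  : loops_map (pmap_comp g f) p == loops_map g (loops_map f p).
Proof.
destruct f as [f e], g as [g e']; unfold loops_map; cbn.
refine (ap2 (fun u v => u @ v @ (ap g e @ e')) (inv_pp _ _) (ap_compose f g p) @ _).
refine (_ @ ap (fun u => inv e' @ u @ e')
  (inv (ap_pp g _ _ @ ap2 concat (ap_V g e) (ap_pp g _ _)))).
refine (inv (concat_assoc _ _ _) @ ap (concat (inv e')) _).
exact (ap (concat _) (concat_assoc _ _ _) @ concat_assoc _ _ _).
Defined.

Lemma loops_map_htpy {A B : pType} (f g : pmap A B) (h : forall x, projT1 f x == projT1 g x)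
  (e : projT2 f == h (ppt A) @ projT2 g) (p : Omega A) : loops_map f p == loops_map g p.
Proof.
destruct f as [f u], g as [g v]; cbn in *.
(* Inverted so that path induction replaces the free end point [u] by [h _ @ v]. *)
assert (e' := inv e); clear e.
path_ind e'; unfold loops_map; cbn.
refine (ap2 concat (inv_pp _ _) (concat_assoc _ _ _ @ ap (fun r => r @ v) (ap_homotopy h p)) @ _).
refine (inv (concat_assoc _ _ _) @ ap (concat (inv v)) _).
exact (ap (concat _) (inv (concat_assoc _ _ _)) @ concat_V_pp _ _).
Defined.

Lemma loops_map_conj {A B : pType} (f : pmap A B) (p : Omega A) (q : Omega B)
  (e : ap (projT1 f) p == projT2 f @ q @ inv (projT2 f)) : loops_map f p == q.
Proof.
refine (ap (fun r => inv _ @ r @ _) e @ _).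
refine (ap (concat _) (inv (concat_assoc _ _ _) @ ap (concat _) _) @ concat_V_pp _ _).
exact (inv (concat_assoc _ _ _) @ ap (concat q) (concat_Vp _) @ concat_p1' _).
Defined.

Definition ev {A B : pType} (y : A) : pmap (PM A B) B :=
  Build_pmap (A := PM A B) (pmap_at y) idpath.

Lemma loops_map_ev {A B : pType} (y : A) (p : Omega (PM A B))
  : loops_map (ev y) p == ap (eval y) p.
Proof.
unfold loops_map; cbn; rewrite inv_1, concat_p1; exact (concat_1p _).
Defined.

(** Such a loop is recovered from its pointed homotopy, a pointed map into a path type; there
    [psec_loops_eq] reduces equality to the underlying functions. *)
Lemma loops_ext {A B : pType} (p q : Omega (PM A B))
  (h : forall y, loops_map (ev y) p == loops_map (ev y) q) : p == q.
Proof.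
refine (inv (phtpy_path_K p) @ ap path_phtpy _ @ phtpy_path_K q).
apply (psec_loops_eq (phtpy_path p) (phtpy_path q)); intros y.
refine (phtpy_path_at p y @ _ @ inv (phtpy_path_at q y)).
exact (inv (loops_map_ev y p) @ h y @ loops_map_ev y q).
Defined.

(** Composition with a constant pointed map gives a constant function whose pointing path need not
    be [idpath]; this path makes [precomp] and [postcomp] pointed. *)
Definition const_path {A B : pType} {b : B} (p : b == ppt B)
  : Build_pmap (A := A) (fun _ => b) p == pmap_const A B.
Proof.
refine (path_phtpy (s := Build_pmap (A := A) (fun _ => b) p) (t := pmap_const A B)
  (mk_psec (fun _ => p) _)).
cbn; rewrite inv_1, concat_p1; exact idpath.
Defined.

Lemma const_path_at {A B : pType} {b : B} (p : b == ppt B) (x : A)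
  : ap (eval x) (const_path (A := A) p) == p.
Proof. exact (path_phtpy_at _ x). Defined.

Definition precomp {A B C : pType} (u : pmap A B) : pmap (PM B C) (PM A C) :=
  Build_pmap (A := PM B C) (B := PM A C) (fun f => pmap_comp f u)
    (const_path (ap (fun _ => ppt C) (projT2 u) @ idpath)).

Definition postcomp {A B C : pType} (c : pmap B C) : pmap (PM A B) (PM A C) :=
  Build_pmap (A := PM A B) (B := PM A C) (fun f => pmap_comp c f)
    (const_path (ap (projT1 c) idpath @ projT2 c)).

Definition pcompose {A B C : pType} : pmap (PM B C) (PM (PM A B) (PM A C)).
Proof.
refine (Build_pmap (A := PM B C) (B := PM (PM A B) (PM A C)) postcomp _).
(* At [f := pmap_const A B] this homotopy is strictly the pointing of [postcomp (pmap_const B C)],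
   so the coherence is [idpath]. *)
refine (path_phtpy (s := postcomp (pmap_const B C)) (t := pmap_const (PM A B) (PM A C))
  (mk_psec (a := pmap_const A B) (fun f : pmap A B =>
     const_path (A := A) (ap (fun _ : B => ppt C) (projT2 f) @ idpath)) _)).
cbn; rewrite inv_1, concat_p1; exact idpath.
Defined.

Lemma loops_map_precomp {A B C : pType} (u : pmap A B) (y : A) (p : Omega (PM B C))
  : loops_map (ev y) (loops_map (precomp u) p) == loops_map (ev (projT1 u y)) p.
Proof.
refine (inv (loops_map_comp (ev y) (precomp u) p)
  @ loops_map_htpy (pmap_comp (ev y) (precomp u)) (ev (projT1 u y)) (fun _ => idpath) _ p).
refine (ap (fun r => r @ idpath) (const_path_at _ y @ _)).
exact (concat_p1' _ @ ap_const (A := B) (ppt C) _).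
Defined.

Lemma loops_map_postcomp {A B C : pType} (c : pmap B C) (y : A) (p : Omega (PM A B))
  : loops_map (ev y) (loops_map (postcomp c) p) == loops_map c (loops_map (ev y) p).
Proof.
refine (inv (loops_map_comp (ev y) (postcomp c) p)
  @ loops_map_htpy (pmap_comp (ev y) (postcomp c)) (pmap_comp c (ev y)) (fun _ => idpath) _ p
  @ loops_map_comp c (ev y) p).
refine (concat_p1' _ @ const_path_at _ y @ _); cbn.
exact (inv (concat_1p _)).
Defined.

(** The underlying functions agree strictly, so only the pointing paths are compared, and both are
    trivial. With [f := cup y] this handles the inner product in [x \smile (y \smile z)]. *)
Lemma loops_map_pcompose {A B C : pType} (f : pmap A B) (y : A) (p : Omega (PM B C))
  : loops_map (ev y) (loops_map (ev (A := PM A B) f) (loops_map pcompose p))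
    == loops_map (ev (projT1 f y)) p.
Proof.
refine (ap (loops_map (ev y)) (inv (loops_map_comp (ev (A := PM A B) f) pcompose p)) @ _).
refine (inv (loops_map_comp (ev y) (pmap_comp (ev (A := PM A B) f) pcompose) p) @ _).
refine (loops_map_htpy (pmap_comp (ev y) (pmap_comp (ev (A := PM A B) f) pcompose))
  (ev (projT1 f y)) (fun _ => idpath) _ p); cbn.
rewrite !concat_p1.
refine (ap (ap (pmap_at y)) (path_phtpy_at (a := pmap_const A B) (P := fun _ => pmap A C)
  (s := postcomp (pmap_const B C)) (t := pmap_const (PM A B) (PM A C)) _ f) @ _).
refine (const_path_at (A := A) (ap (fun _ : B => ppt C) (projT2 f) @ idpath) y @ _).
exact (concat_p1' _ @ ap_const (A := B) (ppt C) _).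
Defined.

(** * Loops [sigma w] and pointed maps out of Eilenberg-MacLane spaces *)

Definition inK (G : AbGroup) (n : nat) : pmap (Kt G n) (K G n) :=
  match n with
  | O => Build_pmap (A := Kt G 0) (B := K G 0) (fun x => x) idpath
  | S n => Build_pmap (A := Kt G (S n)) (B := K G (S n)) (tr _) idpath
  end.

Lemma conj_eq {A : Type} {fA : Fib A} {x y z : A} (u : x == z) (v : y == z) (p : x == x)
  (q : y == y) (e : inv u @ p @ u == inv v @ q @ v) : (u @ inv v) @ q == p @ (u @ inv v).
Proof.
refine (inv (concat_assoc _ _ _) @ ap (concat u) (_ @ ap (fun r => r @ inv v) (inv e)) @ _).
- refine (inv (inv (concat_assoc _ _ _) @ ap (concat (inv v)) _)).
  exact (inv (concat_assoc _ _ _) @ ap (concat q) (concat_pV v) @ concat_p1' q).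
- exact (concat_assoc _ _ _ @ ap (fun r => r @ inv v) (concat_p_Vp _ _)
    @ inv (concat_assoc _ _ _)).
Defined.

Lemma K_ind (G : AbGroup) (n : nat) (P : K G n -> Type) (fP : forall x, Fib (P x))
  (h : forall x, is_trunc (S (S n)) (P x)) (d : forall a, P (projT1 (inK G n) a))
  : forall x, P x.
Proof. destruct n as [|n]; [exact d|exact (Trunc_ind _ P h d)]. Defined.

Lemma sigma_inK (G : AbGroup) (n : nat) (a : Kt G n)
  : projT1 (sigma G n) (projT1 (inK G n) a) = sigma_tr G n a.
Proof. destruct n as [|n]; [reflexivity|exact (Trunc_rec_tr _ _ (sigma_tr G (S n)) a)]. Defined.

(** Transfers to [sigma] the computation rules, which concern [sigma_raw] on the untruncated
    spaces. *)
Lemma loops_map_inK (G : AbGroup) (n : nat) (a : Kt G n)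
  : loops_map (inK G (S n)) (sigma_raw G n a) == projT1 (sigma G n) (projT1 (inK G n) a).
Proof.
rewrite sigma_inK; unfold loops_map; cbn; rewrite inv_1, concat_p1; exact (concat_1p _).
Defined.

Lemma K_map_inK {G H : AbGroup} (phi : Hom G H) (n : nat) (a : Kt G n)
  : projT1 (K_map phi n) (projT1 (inK G n) a) = projT1 (inK H n) (projT1 (Kt_map phi n) a).
Proof.
destruct n as [|n]; [reflexivity|].
exact (Trunc_rec_tr _ _ (fun x => tr _ (projT1 (Kt_map phi (S n)) x)) a).
Defined.

Lemma loops_map_square {A B A' B' : pType} (i : pmap A A') (g : pmap A' B') (f : pmap A B)
  (j : pmap B B') (h : forall x, projT1 g (projT1 i x) == projT1 j (projT1 f x))
  (e : ap (projT1 g) (projT2 i) @ projT2 g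
       == h (ppt A) @ ap (projT1 j) (projT2 f) @ projT2 j) (p : Omega A)
  : loops_map g (loops_map i p) == loops_map j (loops_map f p).
Proof.
refine (inv (loops_map_comp g i p) @ _ @ loops_map_comp j f p).
exact (loops_map_htpy (pmap_comp g i) (pmap_comp j f) h e p).
Defined.

Lemma loops_map_K_map {G H : AbGroup} (phi : Hom G H) (n : nat) (w : K G n)
  : loops_map (K_map phi (S n)) (projT1 (sigma G n) w)
    == projT1 (sigma H n) (projT1 (K_map phi n) w).
Proof.
(* The goal equates loops in an (n+1)-type, hence is an (n-1)-type, and truncation induction on [w]
   applies. *)
revert w; refine (K_ind G n _ _ (fun w => is_trunc_S (S n) _ _ (K_is_trunc H (S n) _ _ _ _)) _).
intros a.
rewrite K_map_inK.
refine (ap (loops_map _) (inv (loops_map_inK G n a)) @ _ @ loops_map_inK H n _).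
refine (loops_map_square (inK G (S n)) (K_map phi (S n)) (Kt_map phi (S n)) (inK H (S n))
  (fun x => of_eq (K_map_inK phi (S n) x)) _ _ @ ap (loops_map _) _).
- cbn. rewrite ap_1, concat_p1; exact (concat_1p _).
- exact (loops_map_conj _ _ _ (ap_Kt_map phi n a)).
Defined.

Lemma KtS_psec (G : AbGroup) (n : nat) (P : Kt G (S n) -> Type) (fP : forall x, Fib (P x))
  (h : forall x, is_trunc (S (S n)) (P x)) (u : P (ppt (Kt G (S n))))
  (l : forall x, transport P (sigma_raw G n x) u == u) : psec (ppt (Kt G (S n))) P u.
Proof.
refine (mk_psec (KtS_ind G n P fP h u l) (of_eq _)).
destruct n as [|n]; [apply K1_ind_star|apply Susp_ind_north].
Defined.

(** A pointed homotopy is built first on the untruncated space: its value at the base point is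
    forced by the pointings of [f] and [g], and [e] is what is needed over the loops [sigma_raw a].
    It extends to the truncation since paths in [E] form n-types. *)
Lemma K_ext (G : AbGroup) (n : nat) (E : pType) (h : is_trunc (S (S (S n))) E)
  (f g : pmap (K G (S n)) E)
  (e : forall w : K G n, loops_map f (projT1 (sigma G n) w)
                      == loops_map g (projT1 (sigma G n) w)) : f == g.
Proof.
assert (s : psec (ppt (Kt G (S n))) (fun x => projT1 f (tr _ x) == projT1 g (tr _ x))
  (projT2 f @ inv (projT2 g))).
{ refine (KtS_psec G n _ _ (fun x => h _ _) _ _); intros a.
  apply (transport_eq (fun x => projT1 f (tr _ x)) (fun x => projT1 g (tr _ x))).
  specialize (e (projT1 (inK G n) a)); rewrite sigma_inK in e.
  refine (ap (concat _) (ap_compose (tr _) (projT1 g) _) @ _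
    @ ap (fun r => r @ _) (inv (ap_compose (tr _) (projT1 f) _))).
  exact (conj_eq _ _ _ _ e). }
pose (P := fun x => projT1 f x == projT1 g x).
pose (t := fun x => is_trunc_S (S (S n)) (P x) _ (h _ _)).
exact (path_phtpy (mk_psec (Trunc_ind _ P t (projT1 s))
  (of_eq (Trunc_ind_tr _ P t (projT1 s) _) @ projT2 s))).
Defined.

(** * The cup product as a pointed map in its first argument *)

Lemma cup_inK (G H : AbGroup) (m n : nat) (a : Kt G n)
  : cup (projT1 (inK G n) a) = cup_raw G H m n a.
Proof. destruct n as [|n]; [reflexivity|apply Trunc_rec_tr]. Defined.

Definition cup_raw_pmap (G H : AbGroup) (m n : nat)
  : pmap (Kt G (S n)) (PM (K H m) (K (tensor G H) (S n + m))) :=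
  Build_pmap (A := Kt G (S n)) (B := PM (K H m) (K (tensor G H) (S n + m)))
    (cup_raw G H m (S n))
    (of_eq match n return cup_raw G H m (S n) (ppt (Kt G (S n))) = pmap_const _ _ with
           | O => cup_raw_star G H m
           | S n => cup_raw_north G H m n
           end).

Definition cup_pmap (G H : AbGroup) (m n : nat)
  : pmap (K G (S n)) (PM (K H m) (K (tensor G H) (S n + m))) :=
  Build_pmap (A := K G (S n)) (B := PM (K H m) (K (tensor G H) (S n + m)))
    cup (of_eq (cup_inK G H m (S n) _) @ projT2 (cup_raw_pmap G H m n)).

Lemma loops_map_cup_raw (G H : AbGroup) (m n : nat) (a : Kt G n) (y : K H m)
  : loops_map (ev y) (loops_map (cup_raw_pmap G H m n) (sigma_raw G n a))
    == projT1 (sigma (tensor G H) (n + m)) (pmap_at y (cup_raw G H m n a)).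
Proof.
refine (inv (loops_map_comp (ev (A := K H m) (B := K (tensor G H) (S n + m)) y)
  (cup_raw_pmap G H m n) _) @ loops_map_conj _ _ _ _).
cbn [pmap_comp Build_pmap projT1 projT2 ev].
rewrite concat_p1.
destruct n as [|n]; [exact (cup_raw_loop G H m y a)|].
pose (f := fun x => pmap_at y (cup_raw G H m (S (S n)) x)).
refine (ap_pp f _ _ @ ap2 concat (cup_raw_merid G H m n y a)
  (ap_V f _ @ ap inv (cup_raw_merid G H m n y _)) @ conj_concat _ _ _ _ @ _).
refine (ap (fun r => _ @ r @ _) (ap (fun r => _ @ inv r) _ @ _)).
(* The meridian at the base point contributes [sigma] of a product with the base point, which is a
   trivial loop. *)
- refine (ap (fun c => projT1 (sigma (tensor G H) (S n + m)) (pmap_at y c))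
    (projT2 (cup_raw_pmap G H m n)) @ projT2 (sigma (tensor G H) (S n + m))).
- cbn; rewrite inv_1; exact (concat_p1' _).
Defined.

Lemma loops_map_cup {G H : AbGroup} {m n : nat} (w : K G n) (y : K H m)
  : loops_map (ev y) (loops_map (cup_pmap G H m n) (projT1 (sigma G n) w))
    == projT1 (sigma (tensor G H) (n + m)) (w \smile y).
Proof.
(* Proved before evaluation at [y]: the pointed maps form an (n+1)-type, low enough for truncation
   induction on [w], whereas at a fixed [y] the level would grow with [m]. *)
assert (c : loops_map (cup_pmap G H m n) (projT1 (sigma G n) w)
  == pmap_loop (pmap_comp (sigma (tensor G H) (n + m)) (cup w))).
{ revert w; refine (K_ind G n _ _
    (fun w => is_trunc_S (S n) _ _ (pmap_K_is_trunc H (tensor G H) (S n) m _ _ _ _)) _).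
  intros a.
  refine (ap (loops_map (cup_pmap G H m n)) (inv (loops_map_inK G n a)) @ _).
  refine (inv (loops_map_comp (cup_pmap G H m n) (inK G (S n)) _)
    @ loops_map_htpy (pmap_comp (cup_pmap G H m n) (inK G (S n)))
      (cup_raw_pmap G H m n) (fun x => of_eq (cup_inK G H m (S n) x)) _ _ @ _).
  { exact (ap (fun r => r @ projT2 (cup_pmap G H m n)) (of_eq (ap_1 _)) @ concat_1p _). }
  apply loops_ext; intros y'; rewrite cup_inK.
  refine (loops_map_cup_raw G H m n a y' @ inv (loops_map_ev y' _ @ _)).
  exact (pmap_loop_at (pmap_comp (sigma (tensor G H) (n + m)) (cup_raw G H m n a)) y'). }
exact (ap (loops_map (ev y)) c @ loops_map_ev y _
  @ pmap_loop_at (pmap_comp (sigma (tensor G H) (n + m)) (cup w)) y).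
Defined.

(** * Naturality and associativity of the cup product *)

Lemma K_map_square {G H H' L : AbGroup} (phi : Hom G H) (phi' : Hom H L) (psi : Hom G H')
  (psi' : Hom H' L) (e : forall g, phi' (phi g) == psi' (psi g)) (n : nat)
  : forall x : K G n, projT1 (K_map phi' n) (projT1 (K_map phi n) x)
                   == projT1 (K_map psi' n) (projT1 (K_map psi n) x).
Proof.
induction n as [|n IH]; [exact e|].
intros x; refine (ap (pmap_at x) (K_ext G n (K L (S n)) (K_is_trunc L (S n))
  (pmap_comp (K_map phi' (S n)) (K_map phi (S n)))
  (pmap_comp (K_map psi' (S n)) (K_map psi (S n))) _)); intros w.
refine (loops_map_comp _ _ _ @ ap (loops_map _) (loops_map_K_map phi n w)
  @ loops_map_K_map phi' n _ @ ap (projT1 (sigma L n)) (IH w) @ inv _).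
exact (loops_map_comp _ _ _ @ ap (loops_map _) (loops_map_K_map psi n w)
  @ loops_map_K_map psi' n _).
Defined.

(** For [cup_pt] in degree 0, where the product with [gzero G] must be the base point of the type of
    pointed maps. *)
Lemma K_map_0 {G H : AbGroup} (phi : Hom G H) (e : forall g, phi g == gzero H) (n : nat)
  : K_map phi n == pmap_const (K G n) (K H n).
Proof.
induction n as [|n IH].
- exact (path_phtpy (s := K_map phi 0) (t := pmap_const (K G 0) (K H 0))
    (mk_psec e (projT1 (gset H _ _ _ _)))).
- apply (K_ext G n (K H (S n)) (K_is_trunc H (S n)) (K_map phi (S n))); intros w.
  refine (loops_map_K_map phi n w @ ap (fun f => projT1 (sigma H n) (pmap_at w f)) IH
    @ projT2 (sigma H n) @ inv _).
  unfold loops_map; cbn; rewrite inv_1, concat_p1.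
  exact (concat_1p _ @ ap_const _ _).
Defined.

Definition cup_pt (G H : AbGroup) (m n : nat)
  : cup (ppt (K G n)) == pmap_const (K H m) (K (tensor G H) (n + m)) :=
  match n return cup (ppt (K G n)) == pmap_const (K H m) (K (tensor G H) (n + m)) with
  | O => K_map_0 (pure_hom (gzero G)) (fun h => hom_0 (pure_hom_l h)) m
  | S n => projT2 (cup_pmap G H m n)
  end.

(** This generality covers associativity for [x] of degree 0: [phi] and [psi] are then given by
    [pure x], and [chi] is [tensor_assoc]. *)
Lemma smile_natural {G G' H L : AbGroup} (phi : Hom G G') (psi : Hom (tensor G H) L)
  (chi : Hom (tensor G' H) L) (e : forall g h, psi (pure g h) == chi (pure (phi g) h))
  (n m : nat)
  : forall (y : K G n) (z : K H m), projT1 (K_map psi (n + m)) (y \smile z)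
      == projT1 (K_map chi (n + m)) (projT1 (K_map phi n) y \smile z).
Proof.
induction n as [|n IH]; intros y z.
{ exact (K_map_square (pure_hom y) psi (pure_hom (phi y)) chi (e y) m z). }
refine (ap (fun f => pmap_at z (pmap_at (A := K G (S n)) (B := PM (K H m) (K L (S n + m))) y f))
  (K_ext G n (PM (K H m) (K L (S n + m))) (pmap_K_is_trunc H L (S n) m)
  (pmap_comp (postcomp (K_map psi (S n + m))) (cup_pmap G H m n))
  (pmap_comp (pmap_comp (postcomp (K_map chi (S n + m))) (cup_pmap G' H m n))
     (K_map phi (S n))) _)); intros w.
apply loops_ext; intros z'.
refine (ap (loops_map (ev z')) (loops_map_comp _ (cup_pmap G H m n) _)
  @ loops_map_postcomp _ _ _ @ ap (loops_map _) (loops_map_cup w z')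
  @ loops_map_K_map psi (n + m) _ @ _).
refine (ap (projT1 (sigma L (n + m))) (IH w z') @ inv _).
refine (ap (loops_map (ev z')) (loops_map_comp _ (K_map phi (S n)) _
    @ ap (loops_map _) (loops_map_K_map phi n w) @ loops_map_comp _ (cup_pmap G' H m n) _)
  @ loops_map_postcomp _ _ _ @ ap (loops_map _) (loops_map_cup _ z')
  @ loops_map_K_map chi (n + m) _).
Defined.

(** By elimination at the base point, each passage to pointed maps lowers the truncation level: by
    [k] for [K H k], then by [m] for [K G m]. *)
Lemma pmap_pmap_K_is_trunc (G H L : AbGroup) (n m k : nat)
  : is_trunc (S (S n)) (PM (K G m) (PM (K H k) (K L (n + (m + k))))).
Proof.
refine (psec_is_trunc (K_elim_point G m) (S (S n))
  (fun _ => pmap (K H k) (K L (n + (m + k)))) _ _ (fun _ => _)).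
refine (psec_is_trunc (K_elim_point H k) (S (S n) + m)
  (fun _ => K L (n + (m + k))) _ _ (fun _ => _)).
change (is_trunc (S (S (n + m + k))) (K L (n + (m + k)))); rewrite add_assoc.
exact (K_is_trunc L _).
Defined.

(* A pointed form of [alpha_star], see [K_map_cast_E]. *)
Definition K_map_cast {G H : AbGroup} (phi : Hom G H) {i j : nat} (e : i = j)
  : pmap (K G i) (K H j) := match e with eq_refl => K_map phi i end.

Lemma K_map_cast_E {G H : AbGroup} (phi : Hom G H) {i j : nat} (e : i = j) (x : K G i)
  : eq_rect i (fun i => K H i) (projT1 (K_map phi i) x) j e = projT1 (K_map_cast phi e) x.
Proof. destruct e; reflexivity. Defined.

(** [f_equal S] is the form to which [add_assoc (S n) m k] reduces. *)
Lemma loops_map_K_map_cast {G H : AbGroup} (phi : Hom G H) {i j : nat} (e : i = j) (w : K G i)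
  : loops_map (K_map_cast phi (f_equal S e)) (projT1 (sigma G i) w)
    == projT1 (sigma H j) (projT1 (K_map_cast phi e) w).
Proof. destruct e; exact (loops_map_K_map phi i w). Defined.

Lemma smile_assoc (G1 G2 G3 : AbGroup) (n m k : nat) (y : K G2 m) (z : K G3 k)
  : forall x : K G1 n, x \smile (y \smile z)
      == projT1 (K_map_cast (tensor_assoc G1 G2 G3) (add_assoc n m k)) ((x \smile y) \smile z).
Proof.
(* The induction hypothesis is used at the arbitrary points [y'] and [z'] at which loops of pointed
   maps are compared. *)
revert y z; induction n as [|n IH]; intros y z x.
{ refine (smile_natural (pure_hom x) (pure_hom x) (tensor_assoc G1 G2 G3) _ m k y z).
  intros g h; exact (inv (tensor_assoc_pure G1 G2 G3 x g h)). }
pose (C := K (tensor G1 (tensor G2 G3)) (S n + (m + k))).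
pose (alpha := K_map_cast (tensor_assoc G1 G2 G3) (add_assoc (S n) m k)).
pose (cup2 := Build_pmap (A := K G2 m) (B := PM (K G3 k) (K (tensor G2 G3) (m + k))) cup
  (cup_pt G2 G3 k m)).
pose (cup1 := cup_pmap G1 (tensor G2 G3) (m + k) n).
pose (cup3 := cup_pmap (tensor G1 G2) G3 k (n + m)).
(* The first map sends [x] to postcomposition with [cup x], restricted along [cup2]; the second
   sends it to [cup x] followed by [cup3] and [alpha]. *)
refine (ap (fun f => pmap_at z (pmap_at (A := K G2 m) (B := PM (K G3 k) C) y
    (pmap_at (A := K G1 (S n)) (B := PM (K G2 m) (PM (K G3 k) C)) x f)))
  (K_ext G1 n (PM (K G2 m) (PM (K G3 k) C)) (pmap_pmap_K_is_trunc _ _ _ (S n) m k)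
    (pmap_comp (precomp cup2) (pmap_comp pcompose cup1))
    (pmap_comp (postcomp (pmap_comp (postcomp alpha) cup3)) (cup_pmap G1 G2 m n)) _)); intros w.
apply loops_ext; intros y'; apply loops_ext; intros z'.
refine (ap (fun p => loops_map (ev z') (loops_map (ev y') p))
    (loops_map_comp (precomp cup2) (pmap_comp pcompose cup1) _) @ _).
refine (ap (loops_map (ev z')) (loops_map_precomp cup2 y' _
    @ ap (loops_map (ev (A := PM (K G3 k) (K (tensor G2 G3) (m + k))) (cup y')))
        (loops_map_comp pcompose cup1 _))
  @ _).
refine (loops_map_pcompose (cup y') z' _ @ loops_map_cup w (y' \smile z') @ _).
refine (ap (projT1 (sigma _ (n + (m + k)))) (IH y' z' w) @ inv _).
(* For the second map, [sigma] is moved outwards past the two products and then past [alpha]. *)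
refine (ap (fun p => loops_map (ev z') (loops_map (ev y') p)) (loops_map_comp _ _ _)
  @ ap (loops_map (ev z')) (loops_map_postcomp _ y' _ @ loops_map_comp _ _ _
    @ ap (fun p => loops_map _ (loops_map _ p)) (loops_map_cup w y'))
  @ loops_map_postcomp _ z' _ @ ap (loops_map alpha) (loops_map_cup (w \smile y') z')
  @ loops_map_K_map_cast _ (add_assoc n m k) _).
Defined.

End Loops.

Theorem proposition30 (T : HoTT) (G1 G2 G3 : AbGroup) (n m k : nat)
  (x : K G1 n) (y : K G2 m) (z : K G3 k) :
  x \smile (y \smile z) == alpha_star G1 G2 G3 n m k ((x \smile y) \smile z).
Proof.
refine (smile_assoc G1 G2 G3 n m k y z x @ of_eq (eq_sym _)).
exact (K_map_cast_E (tensor_assoc G1 G2 G3) (add_assoc n m k) _).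
Qed.
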